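(* Let $f:[0,+\infty)\to\mathbb{R}$ be a function and let $u\in C^2(\overline{\mathbb{R}^2_+})$ be a solution to $$\begin{cases}-\Delta u=f(u) & \text{in } \mathbb{R}^2_+,\\ u>0 & \text{in } \mathbb{R}^2_+,\\ u=0 & \text{on } \partial\mathbb{R}^2_+.\end{cases}$$ Assume that $f$ is continuous on $[0,+\infty)$ and locally Lipschitz continuous from above, and that either (i) $f(0)=0$ and $f$ satisfies the one-sided Osgood condition at every $\bar t\in[0,+\infty)$; or (ii) $f(0)\neq 0$ and $f$ satisfies the one-sided Osgood condition at every $\bar t\in(0,+\infty)$. Then $\dfrac{\partial u}{\partial y}>0$ in $\mathbb{R}^2_+$.
   Context: $\mathbb{R}^2_+=\{(x,y)\in\mathbb{R}^2: y>0\}$ is the open half-plane. A function $f:[0,+\infty)\to\mathbb{R}$ is *locally Lipschitz continuous from above* if for every $b>0$ there is $L_b>0$ such that $f(u)-f(v)\le L_b(u-v)$ for all $0\le v\le u\le b$. $f$ satisfies the *one-sided Osgood condition at* $\bar t\in[0,+\infty)$ if there exist $\delta=\delta(\bar t)>0$ and a continuous function $g:[0,\delta]\to\mathbb{R}$ with $g(0)=0$ such that $f(s)-f(t)\le g(t-s)$ for all $s\le t$ with $s,t\in[\bar t-\frac{\delta}{2},\bar t+\frac{\delta}{2}]\cap[0,+\infty)$, and such that either $g$ vanishes identically on $[0,\delta]$, or $g$ is positive on $(0,\delta]$, non-decreasing on $[0,\delta]$, and $\int_0^\delta \frac{ds}{\sqrt{G(s)}}=\infty$, where $G(s)=\int_0^s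 g(t)\,dt$. *)

(* Defs.v *)
(* Stdlib reals with Coquelicot. *)
From Stdlib Require Export Reals.
From Coquelicot Require Export Coquelicot.
Open Scope R_scope.

Definition open_half_plane (p : R * R) : Prop := 0 < snd p.
Definition closed_half_plane (p : R * R) : Prop := 0 <= snd p.

(* C^k up to the boundary: the partial derivatives of order <= k exist in the
   open half-plane and extend continuously to the closed one; the values of
   wx, wy on the boundary are those of the continuous extensions. *)
Fixpoint C_closed_half_plane (k : nat) (w : R * R -> R) : Prop :=
  continuous_on closed_half_plane w /\
  match k with
  | O => True
  | S k' => exists wx wy : R * R -> R,
      C_closed_half_plane k' wx /\ C_closed_half_plane k' wy /\
      forall x y : R, open_half_plane (x, y) ->
        is_derive (fun t => w (t, y)) x (wx (x, y)) /\
        is_derive (fun t => w (x, t)) y (wy (x, y))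
  end.

Definition laplacian (u : R * R -> R) (x y : R) : R :=
  Derive_n (fun t => u (t, y)) 2 x + Derive_n (fun t => u (x, t)) 2 y.

(* A function on [0, +oo) is represented by a total f : R -> R of which only
   the values on [0, +oo) are ever constrained or used. *)
Definition solution (f : R -> R) (u : R * R -> R) : Prop :=
  (forall x y, open_half_plane (x, y) -> - laplacian u x y = f (u (x, y))) /\
  (forall x y, open_half_plane (x, y) -> 0 < u (x, y)) /\
  (forall x, u (x, 0) = 0).

Definition locally_lipschitz_from_above (f : R -> R) : Prop :=
  forall b : R, 0 < b -> exists L : R, 0 < L /\
    forall u v : R, 0 <= v -> v <= u -> u <= b -> f u - f v <= L * (u - v).

(* int_0^delta ds / sqrt (G s) = +oo, for the nonnegative integrand which may
   be singular at 0 only, as the limit of the integrals over [eps, delta]. *)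
Definition osgood_integral_diverges (g : R -> R) (delta : R) : Prop :=
  filterlim
    (fun eps => RInt (fun s => / sqrt (RInt g 0 s)) eps delta)
    (at_right 0) (Rbar_locally p_infty).

Definition one_sided_osgood (f : R -> R) (tbar : R) : Prop :=
  exists (delta : R) (g : R -> R),
    0 < delta /\
    continuous_on (fun s => 0 <= s <= delta) g /\
    g 0 = 0 /\
    (forall s t : R,
       0 <= s -> tbar - delta / 2 <= s -> s <= t -> t <= tbar + delta / 2 ->
       f s - f t <= g (t - s)) /\
    ((forall s, 0 <= s <= delta -> g s = 0) \/
     ((forall s, 0 < s <= delta -> 0 < g s) /\
      (forall s t, 0 <= s -> s <= t -> t <= delta -> g s <= g t) /\
      osgood_integral_diverges g delta)).

(* Main.v *)
Require Import Defs.
From Stdlib Require Import Reals Lra Classical ClassicalEpsilon.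
From Coquelicot Require Import Coquelicot.
Open Scope R_scope.

(* Moving and rotating lines. Fix a vertical line [x = x0] and reflect [u] across
   lines of small slope [tau <> 0] through [(x0, s)]; such a line, [x = x0] and
   the axis bound a compact triangle, in which the reflection can be compared
   with [u] although [u] may be unbounded on the half-plane. If the comparison
   holds on the side [x = x0] for all [s] up to some height, then it holds in the
   triangles, by increasing [s] from [0]: the maximum principle for domains
   concentrated near their boundary (which needs [f] Lipschitz from above) and
   the strong maximum principle (which needs the Osgood condition) let [s] pass
   every value. Letting [tau] tend to [0] from both sides gives
   [u (x, y) <= u (x, 2 s - y)] for all [x] and [y <= s]. When these inequalities
   hold up to a height, they are strict and [du/dy > 0] there by Hopf's lemma, so
   by compactness of the segment [{x0} x [0, s]] the condition on [x = x0]
   extends a little higher, with small slopes. At the foot [(x0, 0)] one needs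
   [|du/dx| <= K du/dy]: either [du/dy > 0] there (Hopf if [f 0 = 0]), or
   [du/dy = 0] and [d^2u/dy^2 = - f 0 > 0]. *)

(** * Compactness and one-variable calculus *)

(** The two conditions on [f] control opposite signs of the difference. Where [u] exceeds its
    reflection [v], Lipschitz continuity from above bounds [f u - f v] by [L * (u - v)], which is
    what a maximum principle near the boundary needs. Where [u] lies below [v], the laplacian of
    [v - u] is only bounded by [g (v - u)], and [g] need not be Lipschitz: no linear equation stands
    behind Hopf's lemma, so the unknown is first transformed by a function built from [g]. Nothing
    is uniform in [x], so reflections in horizontal lines alone cannot be continued past a given
    height. In a triangle, two sides are harmless: on the axis [u] vanishes and [v] is nonnegative,
    on the slanted side [u] and [v] agree. Only the side on the vertical line needs an assumption,
    and it is compact. As the slope tends to 0 the triangles exhaust one half of the strip, so the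
    single line [x = 0], with slopes of both signs, controls all [x]. The strict inequality on that
    side degenerates at the tip, where a point meets its reflection; this is why a bound on the
    direction of the gradient is needed there. *)

Lemma real_induction (P : R -> Prop) :
  (forall s, 0 <= s -> (forall s', 0 < s' < s -> P s') ->
     exists eps, 0 < eps /\ forall s', 0 < s' < s + eps -> P s') ->
  forall s, 0 < s -> P s.
Proof.
  intros step s0 Hs0.
  destruct (classic (P s0)) as [|Hn]; [assumption|exfalso].
  pose (A := fun s => 0 <= s /\ forall s', 0 < s' < s -> P s').
  assert (Hub : forall s, A s -> s <= s0).
  { intros s [_ HA]. destruct (Rle_dec s s0) as [|Hc]; [assumption|].
    exfalso; apply Hn, HA; lra. }
  destruct (completeness A) as [m [Hm1 Hm2]].
  - exists s0. intros s Hs; exact (Hub s Hs).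
  - exists 0. split; [lra|]. intros; lra.
  (* At the supremum [m], [step] yields [P m] as well as values beyond; at [m = 0] its premise is
     void and it serves as the base case. *)
  - assert (Hm0 : 0 <= m) by (apply Hm1; split; [lra|intros; lra]).
    destruct (step m Hm0) as [e [He Hstep]].
    + intros s' Hs'. apply NNPP; intros Hns.
      assert (m <= s'); [|lra].
      apply Hm2. intros t [Ht HA]. destruct (Rle_dec t s') as [|Hc]; [assumption|].
      exfalso; apply Hns, HA; lra.
    + assert (m + e <= m); [|lra].
      apply Hm1. split; [lra|]. intros; apply Hstep; lra.
Qed.

(** A Lebesgue number argument. The parameter [z] will be a small slope, a small change of height
    or, in [compact_min], a margin. The conclusion reaches [d] beyond the rectangle, which later
    lets a height be pushed past its current bound. *)
Lemma uniform_neighborhood (Phi : R -> R -> R -> Prop) (a b a' b' : R) :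
  (forall x y, a <= x <= b -> a' <= y <= b' -> exists d, 0 < d /\
     forall z x' y', Rabs z < d -> Rabs (x' - x) < d -> Rabs (y' - y) < d ->
       Phi z x' y') ->
  exists d, 0 < d /\ forall z x y, Rabs z < d ->
    a <= b -> a' <= b' -> a - d < x < b + d -> a' - d < y < b' + d -> Phi z x y.
Proof.
  intros H.
  assert (Hd : forall x y, exists d : posreal, a <= x <= b -> a' <= y <= b' ->
     forall z x' y', Rabs z < 2 * d -> Rabs (x' - x) < 2 * d ->
       Rabs (y' - y) < 2 * d -> Phi z x' y').
  { intros x y.
    destruct (classic ((a <= x <= b) /\ (a' <= y <= b'))) as [[Hx Hy]|Hn].
    - destruct (H x y Hx Hy) as [d [Hd HP]].
      assert (Hd2 : 0 < d / 2) by lra.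
      exists (mkposreal _ Hd2); simpl; intros _ _ z x' y' h1 h2 h3; apply HP; lra.
    - exists (mkposreal 1 Rlt_0_1). intros; tauto. }
  pose (delta := fun x y => proj1_sig (constructive_indefinite_description _ (Hd x y))).
  assert (Hdelta : forall x y, a <= x <= b -> a' <= y <= b' ->
     forall z x' y', Rabs z < 2 * delta x y -> Rabs (x' - x) < 2 * delta x y ->
       Rabs (y' - y) < 2 * delta x y -> Phi z x' y').
  { intros x y; unfold delta.
    exact (proj2_sig (constructive_indefinite_description _ (Hd x y))). }
  destruct (compactness_value_2d a b a' b' delta) as [d Hc].
  exists d. split; [apply cond_pos|]. intros z x y hz hab hab' hx hy.
  pose proof (cond_pos d) as hd0.
  (* The nearest point of the rectangle. It is closer than [d], and the factor 2 in [Hd] pays for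
     this detour. *)
  set (x1 := Rmax a (Rmin x b)). set (y1 := Rmax a' (Rmin y b')).
  assert (hx1 : a <= x1 <= b /\ Rabs (x - x1) < d).
  { unfold x1, Rmax, Rmin.
    repeat destruct Rle_dec; (split; [lra|apply Rabs_def1; lra]). }
  assert (hy1 : a' <= y1 <= b' /\ Rabs (y - y1) < d).
  { unfold y1, Rmax, Rmin.
    repeat destruct Rle_dec; (split; [lra|apply Rabs_def1; lra]). }
  apply NNPP; intros Hn.
  apply (Hc x1 y1 (proj1 hx1) (proj1 hy1)).
  intros [u [v [hu [hv [h1 [h2 h3]]]]]].
  apply Hn, (Hdelta u v hu hv).
  - pose proof (cond_pos (delta u v)); lra.
  - destruct hx1 as [_ hx1]. replace (x - u) with ((x - x1) + (x1 - u)) by ring.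
    pose proof (Rabs_triang (x - x1) (x1 - u)); lra.
  - destruct hy1 as [_ hy1]. replace (y - v) with ((y - y1) + (y1 - v)) by ring.
    pose proof (Rabs_triang (y - y1) (y1 - v)); lra.
Qed.

Lemma continuous_pair_eps (F : R * R -> R) (x y : R) :
  continuous F (x, y) -> forall e, 0 < e -> exists d, 0 < d /\
    forall x' y', Rabs (x' - x) < d -> Rabs (y' - y) < d ->
      Rabs (F (x', y') - F (x, y)) < e.
Proof.
  intros HF e He.
  destruct (proj1 (filterlim_locally F (F (x, y))) HF (mkposreal e He)) as [d Hd].
  exists d; split; [apply cond_pos|]. intros x' y' h1 h2.
  apply (Hd (x', y')). split; assumption.
Qed.

Lemma closed_compl_nbhs (K : R * R -> Prop) (x y : R) :
  closed K -> ~ K (x, y) -> exists d, 0 < d /\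
    forall x' y', Rabs (x' - x) < d -> Rabs (y' - y) < d -> ~ K (x', y').
Proof.
  intros HK Hn. apply NNPP; intros Hne. apply Hn, HK. intros [d Hd].
  apply Hne. exists d; split; [apply cond_pos|]. intros x' y' h1 h2.
  apply (Hd (x', y')). split; assumption.
Qed.

(** Both halves of the extreme value theorem come from [uniform_neighborhood], with [z] encoding a
    bound. A local lower bound [- A] is stored as [- / Rabs z <= F] for small [z], so that a uniform
    [d] is a global bound. If the infimum were not attained, [Rabs z] would record a uniform
    positive gap above it. *)
Lemma compact_min (K : R * R -> Prop) (F : R * R -> R) (a b a' b' : R) :
  closed K -> (forall x y, K (x, y) -> a <= x <= b /\ a' <= y <= b') ->
  (forall p, K p -> continuous F p) -> (exists p, K p) ->
  exists p, K p /\ forall q, K q -> F p <= F q.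
Proof.
  intros HK Hb HF [[x0 y0] Hp0].
  destruct (Hb _ _ Hp0) as [Hx0 Hy0].
  assert (Hbd : exists m, forall q, K q -> m <= F q).
  { destruct (uniform_neighborhood
      (fun z x y => K (x, y) -> z <> 0 -> - / Rabs z <= F (x, y)) a b a' b')
      as [d [Hd HP]].
    - intros x y _ _. destruct (classic (K (x, y))) as [Hk|Hk].
      + destruct (continuous_pair_eps F x y (HF _ Hk) 1 Rlt_0_1) as [d [Hd Hc]].
        set (A := Rabs (F (x, y)) + 1).
        assert (HA : 0 < A) by (unfold A; pose proof (Rabs_pos (F (x, y))); lra).
        exists (Rmin d (/ A)). split.
        { apply Rmin_glb_lt; [assumption|apply Rinv_0_lt_compat; assumption]. }
        intros z x' y' hz hx hy _ hz0.
        assert (hh := Hc x' y' (Rlt_le_trans _ _ _ hx (Rmin_l _ _))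
                        (Rlt_le_trans _ _ _ hy (Rmin_l _ _))).
        apply Rabs_def2 in hh.
        assert (A <= / Rabs z).
        { rewrite <- (Rinv_inv A). apply Rinv_le_contravar.
          - apply Rabs_pos_lt; assumption.
          - left. apply (Rlt_le_trans _ _ _ hz (Rmin_r _ _)). }
        unfold A in *. pose proof (Rle_abs (- F (x, y))).
        rewrite Rabs_Ropp in H0. lra.
      + destruct (closed_compl_nbhs K x y HK Hk) as [d [Hd Hc]].
        exists d; split; [assumption|]. intros z x' y' _ h1 h2 Hk'.
        exfalso; exact (Hc x' y' h1 h2 Hk').
    - exists (- / Rabs (d / 2)). intros [x y] Hk. destruct (Hb _ _ Hk).
      apply HP; try lra; try assumption. rewrite Rabs_pos_eq; lra. }
  destruct Hbd as [m0 Hm0].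
  destruct (completeness (fun r => exists q, K q /\ r = - F q)) as [M [HM1 HM2]].
  { exists (- m0). intros r [q [Hq ->]]. specialize (Hm0 q Hq). lra. }
  { exists (- F (x0, y0)), (x0, y0). split; [assumption|reflexivity]. }
  assert (HMl : forall q, K q -> - M <= F q).
  { intros q Hq. assert (- F q <= M); [|lra]. apply HM1. exists q; split; auto. }
  apply NNPP; intros Hne.
  assert (Hlt : forall q, K q -> - M < F q).
  { intros q Hq. destruct (HMl q Hq) as [|He]; [assumption|].
    exfalso; apply Hne. exists q; split; [assumption|]. intros; rewrite <- He; auto. }
  destruct (uniform_neighborhood
      (fun z x y => K (x, y) -> - M + Rabs z <= F (x, y)) a b a' b')
      as [d [Hd HP]].
  - intros x y _ _. destruct (classic (K (x, y))) as [Hk|Hk].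
    + set (e := (F (x, y) + M) / 2).
      assert (He : 0 < e) by (unfold e; specialize (Hlt _ Hk); lra).
      destruct (continuous_pair_eps F x y (HF _ Hk) e He) as [d [Hd Hc]].
      exists (Rmin d e). split; [apply Rmin_glb_lt; assumption|].
      intros z x' y' hz hx hy _.
      assert (hh := Hc x' y' (Rlt_le_trans _ _ _ hx (Rmin_l _ _))
                        (Rlt_le_trans _ _ _ hy (Rmin_l _ _))).
      apply Rabs_def2 in hh. assert (hz' := Rlt_le_trans _ _ _ hz (Rmin_r _ _)).
      unfold e in *. lra.
    + destruct (closed_compl_nbhs K x y HK Hk) as [d [Hd Hc]].
      exists d; split; [assumption|]. intros z x' y' _ h1 h2 Hk'.
      exfalso; exact (Hc x' y' h1 h2 Hk').
  - assert (M <= M - d / 2); [|lra].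
    apply HM2. intros r [[x y] [Hq ->]]. destruct (Hb _ _ Hq).
    assert (- M + Rabs (d / 2) <= F (x, y)).
    { apply HP; try lra; try assumption. rewrite Rabs_pos_eq; lra. }
    rewrite Rabs_pos_eq in H1; lra.
Qed.

(** Differentiability is asked only in the open interval because segments will start on the axis,
    where the derivatives of the solution are merely continuous extensions. *)
Lemma MVT_open (f df : R -> R) (a b : R) :
  a < b -> (forall x, a < x < b -> is_derive f x (df x)) ->
  (forall x, a <= x <= b -> continuity_pt f x) ->
  exists c, a < c < b /\ f b - f a = df c * (b - a).
Proof.
  intros Hab Hd Hc.
  set (pr := fun c (P : a < c < b) =>
    exist (fun l => derivable_pt_abs f c l) (df c) (proj1 (is_derive_Reals f c (df c)) (Hd c P))
    : derivable_pt f c).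
  destruct (MVT f id a b pr (fun c _ => derivable_pt_id c) Hab Hc
     (fun c _ => derivable_continuous_pt id c (derivable_pt_id c))) as [c [P H]].
  exists c. split; [assumption|]. rewrite derive_pt_id in H. unfold id in H.
  simpl in H. lra.
Qed.

Lemma derive_ge_slope (phi : R -> R) (d a t0 : R) :
  is_derive phi 0 d -> 0 < t0 -> (forall t, 0 < t <= t0 -> phi 0 + a * t <= phi t) -> a <= d.
Proof.
  intros Hd Ht0 H. apply Rnot_lt_le; intros Hlt.
  apply is_derive_Reals in Hd. destruct (Hd (a - d)) as [e He]; [lra|].
  set (t := Rmin e t0 / 2).
  assert (Ht : 0 < t < e /\ t <= t0).
  { pose proof (Rmin_glb_lt e t0 0 (cond_pos e) Ht0).
    pose proof (Rmin_l e t0). pose proof (Rmin_r e t0). unfold t; lra. }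
  specialize (He t ltac:(lra)). rewrite (Rabs_pos_eq t) in He by lra.
  specialize (He ltac:(lra)). apply Rabs_def2 in He. rewrite Rplus_0_l in He.
  assert (Hq : (phi t - phi 0) / t < a) by lra.
  apply (Rmult_lt_compat_r t) in Hq; [|lra].
  unfold Rdiv in Hq. rewrite Rmult_assoc, Rinv_l in Hq by lra.
  specialize (H t). lra.
Qed.

(** A relation with explicit values, so that at a minimum the second derivatives of a compound
    expression can be assembled by the rules below. *)
Definition derive2 (h : R -> R) (x d1 d2 : R) : Prop :=
  exists h1 : R -> R, locally x (fun t => is_derive h t (h1 t)) /\
    h1 x = d1 /\ is_derive h1 x d2.

Lemma is_derive_local_min (h : R -> R) (x d : R) :
  is_derive h x d -> locally x (fun t => h x <= h t) -> d = 0.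
Proof.
  intros Hd [e He].
  apply is_derive_Reals in Hd.
  destruct (Rtotal_order d 0) as [Hl|[Hz|Hg]]; [exfalso|assumption|exfalso].
  - destruct (Hd (- d / 2)) as [a Ha]; [lra|].
    assert (Hm : 0 < Rmin a e / 2).
    { pose proof (Rmin_glb_lt a e 0 (cond_pos a) (cond_pos e)); lra. }
    assert (Hma := Rmin_l a e). assert (Hme := Rmin_r a e).
    set (r := Rmin a e / 2) in *.
    assert (H1 := Ha r). specialize (H1 ltac:(lra)).
    rewrite (Rabs_pos_eq r) in H1 by lra. specialize (H1 ltac:(unfold r in *; lra)).
    assert (H2 : h x <= h (x + r)).
    { apply He. unfold ball; simpl; unfold AbsRing_ball, abs, minus, plus, opp; simpl.
      replace (x + r + - x) with r by ring. rewrite Rabs_pos_eq; unfold r in *; lra. }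
    apply Rabs_def2 in H1.
    assert (0 <= (h (x + r) - h x) / r).
    { apply Rmult_le_pos; [lra|left; apply Rinv_0_lt_compat; assumption]. }
    lra.
  - destruct (Hd (d / 2)) as [a Ha]; [lra|].
    assert (Hm : 0 < Rmin a e / 2).
    { pose proof (Rmin_glb_lt a e 0 (cond_pos a) (cond_pos e)); lra. }
    assert (Hma := Rmin_l a e). assert (Hme := Rmin_r a e).
    set (r := Rmin a e / 2) in *.
    assert (H1 := Ha (- r)). specialize (H1 ltac:(lra)).
    rewrite Rabs_Ropp, (Rabs_pos_eq r) in H1 by lra.
    specialize (H1 ltac:(unfold r in *; lra)).
    assert (H2 : h x <= h (x + - r)).
    { apply He. unfold ball; simpl; unfold AbsRing_ball, abs, minus, plus, opp; simpl.
      replace (x + - r + - x) with (- r) by ring.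
      rewrite Rabs_Ropp, Rabs_pos_eq; unfold r in *; lra. }
    apply Rabs_def2 in H1.
    assert ((h (x + - r) - h x) / - r <= 0).
    { replace ((h (x + - r) - h x) / - r) with (- ((h (x + - r) - h x) / r))
        by (field; lra).
      assert (0 <= (h (x + - r) - h x) / r); [|lra].
      apply Rmult_le_pos; [lra|left; apply Rinv_0_lt_compat; assumption]. }
    lra.
Qed.

Lemma derive2_local_min (h : R -> R) (x d1 d2 : R) :
  derive2 h x d1 d2 -> locally x (fun t => h x <= h t) -> d1 = 0 /\ 0 <= d2.
Proof.
  intros [h1 [H1 [Hx H2]]] Hm.
  assert (Hd1 : d1 = 0).
  { rewrite <- Hx. apply (is_derive_local_min h x); [|assumption].
    apply (locally_singleton _ _ H1). }
  split; [assumption|].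
  destruct (Rle_dec 0 d2) as [|Hn]; [assumption|exfalso].
  apply Rnot_le_lt in Hn.
  destruct H1 as [e1 He1]. destruct Hm as [e2 He2].
  apply is_derive_Reals in H2.
  destruct (H2 (- d2 / 2)) as [a Ha]; [lra|].
  set (r := Rmin a (Rmin e1 e2) / 2).
  assert (Hr : 0 < r < a /\ r < e1 /\ r < e2).
  { pose proof (Rmin_glb_lt e1 e2 0 (cond_pos e1) (cond_pos e2)).
    pose proof (Rmin_glb_lt a _ 0 (cond_pos a) H).
    pose proof (Rmin_l a (Rmin e1 e2)). pose proof (Rmin_r a (Rmin e1 e2)).
    pose proof (Rmin_l e1 e2). pose proof (Rmin_r e1 e2). unfold r; lra. }
  assert (Hder : forall t, x <= t <= x + r -> is_derive h t (h1 t)).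
  { intros t Ht. apply He1. unfold ball; simpl; unfold AbsRing_ball, abs, minus, plus, opp; simpl.
    apply Rabs_def1; lra. }
  (* [h1] is negative just to the right of [x], so [h] decreases there *)
  assert (Hneg : forall t, x < t <= x + r -> h1 t < 0).
  { intros t Ht. assert (Hq := Ha (t - x)). specialize (Hq ltac:(lra)).
    rewrite (Rabs_pos_eq (t - x)) in Hq by lra. specialize (Hq ltac:(lra)).
    replace (x + (t - x)) with t in Hq by ring. apply Rabs_def2 in Hq.
    rewrite Hx, Hd1 in Hq.
    assert (Hlt : (h1 t - 0) / (t - x) < 0) by lra.
    replace (h1 t) with ((h1 t - 0) / (t - x) * (t - x)) by (field; lra).
    nra. }
  destruct (MVT_open h h1 x (x + r)) as [c [Hc Heq]].
  - lra.
  - intros t Ht. apply Hder; lra.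
  - intros t Ht. apply derivable_continuous_pt.
    exists (h1 t). apply is_derive_Reals, Hder; lra.
  - assert (h x <= h (x + r)).
    { apply He2. unfold ball; simpl; unfold AbsRing_ball, abs, minus, plus, opp; simpl.
      apply Rabs_def1; lra. }
    assert (h1 c < 0) by (apply Hneg; lra).
    nra.
Qed.

Lemma derive2_plus (h k : R -> R) (x d1 d2 e1 e2 : R) :
  derive2 h x d1 d2 -> derive2 k x e1 e2 ->
  derive2 (fun t => h t + k t) x (d1 + e1) (d2 + e2).
Proof.
  intros [h1 [H1 [Hx H2]]] [k1 [K1 [Kx K2]]].
  exists (fun t => h1 t + k1 t). split; [|split].
  - generalize (filter_and _ _ H1 K1). apply filter_imp.
    intros t [A B]. exact (is_derive_plus h k t _ _ A B).
  - rewrite Hx, Kx; reflexivity.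
  - exact (is_derive_plus h1 k1 x _ _ H2 K2).
Qed.

Lemma derive2_scal (h : R -> R) (x c d1 d2 : R) :
  derive2 h x d1 d2 -> derive2 (fun t => c * h t) x (c * d1) (c * d2).
Proof.
  intros [h1 [H1 [Hx H2]]].
  exists (fun t => c * h1 t). split; [|split].
  - generalize H1. apply filter_imp.
    intros t A. exact (is_derive_scal h t c _ A).
  - rewrite Hx; reflexivity.
  - exact (is_derive_scal h1 x c _ H2).
Qed.

Lemma derive2_ext (h k : R -> R) (x d1 d2 : R) :
  (forall t, h t = k t) -> derive2 h x d1 d2 -> derive2 k x d1 d2.
Proof.
  intros He [h1 [H1 [Hx H2]]]. exists h1; split; [|split; assumption].
  generalize H1; apply filter_imp. intros t. apply is_derive_ext; assumption.
Qed.

Lemma derive2_minus (h k : R -> R) (x d1 d2 e1 e2 : R) :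
  derive2 h x d1 d2 -> derive2 k x e1 e2 ->
  derive2 (fun t => h t - k t) x (d1 - e1) (d2 - e2).
Proof.
  intros H K.
  replace (d1 - e1) with (d1 + (-1) * e1) by ring.
  replace (d2 - e2) with (d2 + (-1) * e2) by ring.
  apply (derive2_ext (fun t => h t + (-1) * k t)); [intros; ring|].
  apply derive2_plus; [assumption|]. apply derive2_scal; assumption.
Qed.

Lemma derive2_comp (T T1 h : R -> R) (x t2 d1 d2 : R) :
  (forall s, is_derive T s (T1 s)) -> is_derive T1 (h x) t2 ->
  derive2 h x d1 d2 ->
  derive2 (fun t => T (h t)) x (T1 (h x) * d1) (t2 * d1 ^ 2 + T1 (h x) * d2).
Proof.
  intros HT HT1 [h1 [H1 [Hx H2]]].
  assert (Hd := locally_singleton _ _ H1).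
  exists (fun t => h1 t * T1 (h t)). split; [|split].
  - generalize H1; apply filter_imp. intros t A.
    exact (is_derive_comp T h t _ _ (HT _) A).
  - rewrite Hx; ring.
  - replace (t2 * d1 ^ 2 + T1 (h x) * d2)
      with (d2 * T1 (h x) + h1 x * (h1 x * t2)) by (rewrite Hx; ring).
    apply (is_derive_mult h1 (fun t => T1 (h t))).
    + assumption.
    + exact (is_derive_comp T1 h x _ _ HT1 Hd).
    + intros; apply Rmult_comm.
Qed.

(** * Osgood's condition *)

Lemma continuous_Rplus {T : UniformSpace} (f g : T -> R) (x : T) :
  continuous f x -> continuous g x -> continuous (fun t => f t + g t) x.
Proof. exact (continuous_plus f g x). Qed.

Lemma continuous_Rminus {T : UniformSpace} (f g : T -> R) (x : T) :
  continuous f x -> continuous g x -> continuous (fun t => f t - g t) x.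
Proof. exact (continuous_minus f g x). Qed.

Lemma continuous_Ropp {T : UniformSpace} (f : T -> R) (x : T) :
  continuous f x -> continuous (fun t => - f t) x.
Proof. exact (continuous_opp f x). Qed.

Lemma continuous_Rmult {T : UniformSpace} (f g : T -> R) (x : T) :
  continuous f x -> continuous g x -> continuous (fun t => f t * g t) x.
Proof. exact (continuous_mult f g x). Qed.

Lemma continuous_pow {T : UniformSpace} (f : T -> R) (n : nat) (x : T) :
  continuous f x -> continuous (fun t => f t ^ n) x.
Proof.
  intros Hf. induction n as [|n IH]; simpl.
  - apply continuous_const.
  - apply continuous_Rmult; assumption.
Qed.

Lemma continuous_to_pair {T : UniformSpace} (f g : T -> R) (x : T) :
  continuous f x -> continuous g x -> continuous (fun t => (f t, g t)) x.
Proof.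
  intros Hf Hg. apply filterlim_locally. intros eps.
  assert (A := proj1 (filterlim_locally f (f x)) Hf eps).
  assert (B := proj1 (filterlim_locally g (g x)) Hg eps).
  generalize (filter_and _ _ A B). apply filter_imp.
  intros t [a b]. split; assumption.
Qed.

Lemma continuous_after {S T U : UniformSpace} (f : S -> T) (g : T -> U) (x : S) :
  (forall y, continuous g y) -> continuous f x -> continuous (fun t => g (f t)) x.
Proof. intros Hg Hf. exact (continuous_comp f g x Hf (Hg _)). Qed.

Ltac cont :=
  lazymatch goal with
  | |- continuous fst _ => apply continuous_fst
  | |- continuous snd _ => apply continuous_snd
  | |- continuous (fun t => t) _ => apply continuous_id
  | |- continuous (fun t => fst t) _ => apply continuous_fst
  | |- continuous (fun t => snd t) _ => apply continuous_snd
  | |- continuous (fun t => @?f t + @?g t) ?x => apply (continuous_Rplus f g x); cont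
  | |- continuous (fun t => @?f t - @?g t) ?x => apply (continuous_Rminus f g x); cont
  | |- continuous (fun t => - @?f t) ?x => apply (continuous_Ropp f x); cont
  | |- continuous (fun t => @?f t * @?g t) ?x => apply (continuous_Rmult f g x); cont
  | |- continuous (fun t => @?f t ^ ?n) ?x => apply (continuous_pow f n x); cont
  | |- continuous (fun t => (@?f t, @?g t)) ?x => apply (continuous_to_pair f g x); cont
  | |- _ => first [assumption | simple apply continuous_const | idtac]
  end.

(** Composition with a map into [D], such as a truncation by [Rmax] and [Rmin], turns continuity
    relative to [D] into plain continuity. All functions given on a closed set are made total and
    continuous in this way. *)
Lemma continuous_on_comp {S T U : UniformSpace} (D : T -> Prop) (f : T -> U)
    (phi : S -> T) (x : S) :
  continuous_on D f -> (forall y, D (phi y)) -> continuous phi x ->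
  continuous (fun y => f (phi y)) x.
Proof.
  intros Hf HD Hphi P HP.
  assert (A := Hf (phi x) (HD x) P HP).
  assert (B := Hphi _ A).
  unfold filtermap in *. generalize B; apply filter_imp. intros y Hy. apply Hy, HD.
Qed.

Lemma continuous_Rmax_l (c x : R) : continuous (Rmax c) x.
Proof.
  apply (continuous_ext (fun t => (c + t + Rabs (c - t)) * / 2)).
  { intros t. unfold Rmax, Rabs. destruct Rle_dec, Rcase_abs; lra. }
  cont. apply (continuous_Rabs_comp (fun t => c - t)). cont.
Qed.

Lemma continuous_Rmin_r (c x : R) : continuous (fun t => Rmin t c) x.
Proof.
  apply (continuous_ext (fun t => (t + c - Rabs (t - c)) * / 2)).
  { intros t. unfold Rmin, Rabs. destruct Rle_dec, Rcase_abs; lra. }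
  cont. apply (continuous_Rabs_comp (fun t => t - c)). cont.
Qed.

Lemma locally_gt {T : UniformSpace} (f : T -> R) (x : T) (c : R) :
  continuous f x -> c < f x -> locally x (fun t => c < f t).
Proof. intros Hf Hc. exact (Hf _ (open_gt c (f x) Hc)). Qed.

Lemma locally_lt {T : UniformSpace} (f : T -> R) (x : T) (c : R) :
  continuous f x -> f x < c -> locally x (fun t => f t < c).
Proof. intros Hf Hc. exact (Hf _ (open_lt c (f x) Hc)). Qed.

Lemma closed_ge_continuous {T : UniformSpace} (f : T -> R) (c : R) :
  (forall x, continuous f x) -> closed (fun x => c <= f x).
Proof. intros Hf. exact (closed_comp f (fun y => c <= y) Hf (closed_ge c)). Qed.

Lemma closed_le_continuous {T : UniformSpace} (f : T -> R) (c : R) :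
  (forall x, continuous f x) -> closed (fun x => f x <= c).
Proof. intros Hf. exact (closed_comp f (fun y => y <= c) Hf (closed_le c)). Qed.

(** * The divergent integral as an unbounded travel time *)

Lemma ex_RInt_everywhere_continuous (g : R -> R) (a b : R) :
  (forall s, continuous g s) -> ex_RInt g a b.
Proof. intros Hg. apply (ex_RInt_continuous g). intros; apply Hg. Qed.

Lemma is_derive_primitive (g : R -> R) (s : R) :
  (forall s, continuous g s) -> is_derive (fun s => RInt g 0 s) s (g s).
Proof.
  intros Hg. apply (is_derive_RInt g (fun s => RInt g 0 s) 0).
  - apply filter_forall. intros t. apply (RInt_correct g).
    apply ex_RInt_everywhere_continuous; assumption.
  - apply Hg.
Qed.

Lemma continuous_is_derive (f : R -> R) (x d : R) : is_derive f x d -> continuous f x.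
Proof. intros H. apply (ex_derive_continuous f). exists d; assumption. Qed.

(** The integral is the time in which the solution of [h'' = D * g h], [h 0 = 0], [h' 0 = a] reaches
    [m], by conservation of energy: [h' ^ 2 = a ^ 2 + 2 * D * G h]. Osgood's condition says that
    this time is unbounded for small [a]. *)
Definition osgood_fun (g : R -> R) : Prop :=
  (forall s, continuous g s) /\ (forall s, s <= 0 -> g s = 0) /\
  (forall s, 0 < s -> 0 < g s) /\
  (forall D m N, 0 < D -> 0 < m -> exists a, 0 < a /\
     N <= RInt (fun s => / sqrt (a ^ 2 + 2 * D * RInt g 0 s)) 0 m).

Lemma primitive_nonneg (g : R -> R) (s : R) :
  (forall s, continuous g s) -> (forall s, s <= 0 -> g s = 0) ->
  (forall s, 0 < s -> 0 < g s) -> 0 <= RInt g 0 s.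
Proof.
  intros Hc H0 Hp. destruct (Rle_dec 0 s) as [Hs|Hs].
  - apply RInt_ge_0; [assumption|apply ex_RInt_everywhere_continuous; assumption|].
    intros x Hx. left; apply Hp; lra.
  - rewrite (RInt_ext g (fun _ => 0)).
    + rewrite RInt_const. unfold scal; simpl; unfold mult; simpl. lra.
    + intros x. rewrite Rmin_right, Rmax_left by lra. intros; apply H0; lra.
Qed.

Lemma continuous_inv_sqrt {T : UniformSpace} (f : T -> R) (x : T) :
  continuous f x -> 0 < f x -> continuous (fun t => / sqrt (f t)) x.
Proof.
  intros Hf Hp.
  apply (continuous_comp f (fun y => / sqrt y) x Hf).
  apply (continuous_comp sqrt Rinv).
  - apply continuous_sqrt.
  - apply continuous_Rinv. apply Rgt_not_eq, sqrt_lt_R0; assumption.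
Qed.

(** Take [a ^ 2 = 2 * D * G eps]. For [s >= eps] the quantity under the root is at most
    [4 * D * G s], so the integral over [[eps, m1]] dominates [/ sqrt (4 * D)] times the divergent
    one. *)
Lemma osgood_fun_intro (g : R -> R) (delta : R) :
  0 < delta -> (forall s, continuous g s) -> (forall s, s <= 0 -> g s = 0) ->
  (forall s, 0 < s -> 0 < g s) -> osgood_integral_diverges g delta ->
  osgood_fun g.
Proof.
  intros Hdelta Hc H0 Hp Hdiv. repeat split; try assumption.
  intros D m N HD Hm.
  set (G := fun s => RInt g 0 s).
  assert (HGc : forall s, continuous G s).
  { intros s. exact (continuous_is_derive _ _ _ (is_derive_primitive g s Hc)). }
  assert (HG0 : forall s, 0 <= G s) by (intros; apply primitive_nonneg; assumption).
  assert (HGm : forall s t, 0 <= s -> s <= t -> G s <= G t).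
  { intros s t Hs Hst. unfold G.
    rewrite <- (RInt_Chasles g 0 s t); try (apply ex_RInt_everywhere_continuous; assumption).
    assert (0 <= RInt g s t).
    { apply RInt_ge_0; [assumption|apply ex_RInt_everywhere_continuous; assumption|].
      intros; left; apply Hp; lra. }
    unfold plus; simpl. lra. }
  assert (HGp : forall s, 0 < s -> 0 < G s).
  { intros s Hs. apply RInt_gt_0; try assumption; intros; [apply Hp; lra|apply Hc]. }
  set (m1 := Rmin m delta).
  assert (Hm1 : 0 < m1 /\ m1 <= m /\ m1 <= delta).
  { unfold m1. split; [apply Rmin_glb_lt; assumption|split; [apply Rmin_l|apply Rmin_r]]. }
  set (I := fun s => / sqrt (G s)).
  assert (HIc : forall s, 0 < s -> continuous I s).
  { intros s Hs. apply continuous_inv_sqrt; [apply HGc|apply HGp; assumption]. }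
  assert (HIex : forall s t, 0 < s -> s <= t -> ex_RInt I s t).
  { intros s t Hs Hst. apply (ex_RInt_continuous I). intros z.
    rewrite Rmin_left by lra. intros; apply HIc; lra. }
  (* The second summand discards the piece of the divergent integral beyond [m1]; the first
     anticipates the factor [/ sqrt (4 * D)]. *)
  set (Bd := Rmax 0 (N * sqrt (4 * D)) + RInt I m1 delta).
  destruct (Hdiv (fun y => Bd < y)) as [e He].
  { exists Bd. intros; assumption. }
  set (eps := Rmin e m1 / 2).
  assert (Heps : 0 < eps /\ eps < e /\ eps < m1).
  { pose proof (Rmin_glb_lt e m1 0 (cond_pos e) (proj1 Hm1)).
    pose proof (Rmin_l e m1). pose proof (Rmin_r e m1). unfold eps; lra. }
  assert (HB : Bd < RInt I eps delta).
  { apply (He eps); [|lra]. unfold ball; simpl; unfold AbsRing_ball, abs, minus, plus, opp; simpl.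
    apply Rabs_def1; lra. }
  rewrite <- (RInt_Chasles I eps m1 delta) in HB by (apply HIex; lra).
  unfold plus in HB; simpl in HB.
  assert (HB' : N * sqrt (4 * D) < RInt I eps m1).
  { unfold Bd in HB. pose proof (Rmax_r 0 (N * sqrt (4 * D))). lra. }
  set (A := 2 * D * G eps).
  assert (HA : 0 < A).
  { unfold A. apply Rmult_lt_0_compat; [lra|apply HGp; lra]. }
  exists (sqrt A). split; [apply sqrt_lt_R0; assumption|].
  replace (sqrt A ^ 2) with A by (rewrite <- Rsqr_pow2, Rsqr_sqrt; lra).
  set (J := fun s => / sqrt (A + 2 * D * G s)).
  change (N <= RInt J 0 m).
  assert (HJp : forall s, 0 < A + 2 * D * G s).
  { intros s. specialize (HG0 s). nra. }
  assert (HJc : forall s, continuous J s).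
  { intros s. apply continuous_inv_sqrt; [|apply HJp].
    cont. apply HGc. }
  assert (HJ0 : forall s t, s <= t -> 0 <= RInt J s t).
  { intros s t Hst. apply RInt_ge_0; [assumption|apply ex_RInt_everywhere_continuous; assumption|].
    intros; left; apply Rinv_0_lt_compat, sqrt_lt_R0, HJp. }
  rewrite <- (RInt_Chasles J 0 eps m) by (apply ex_RInt_everywhere_continuous; assumption).
  rewrite <- (RInt_Chasles J eps m1 m) by (apply ex_RInt_everywhere_continuous; assumption).
  unfold plus; simpl.
  assert (HJ1 := HJ0 0 eps ltac:(lra)). assert (HJ2 := HJ0 m1 m ltac:(lra)).
  assert (H4D : 0 < sqrt (4 * D)) by (apply sqrt_lt_R0; lra).
  assert (Hle : / sqrt (4 * D) * RInt I eps m1 <= RInt J eps m1).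
  { replace (/ sqrt (4 * D) * RInt I eps m1)
      with (RInt (fun s => scal (/ sqrt (4 * D)) (I s)) eps m1)
      by exact (RInt_scal I eps m1 _ (HIex eps m1 ltac:(lra) ltac:(lra))).
    apply RInt_le; [lra| | |].
    - apply (ex_RInt_scal I). apply HIex; lra.
    - apply ex_RInt_everywhere_continuous; assumption.
    - intros s Hs. unfold scal; simpl; unfold mult; simpl. unfold I, J.
      rewrite <- Rinv_mult, <- sqrt_mult by (try apply HG0; lra).
      apply Rinv_le_contravar; [apply sqrt_lt_R0, HJp|].
      apply sqrt_le_1_alt. unfold A.
      assert (G eps <= G s) by (apply HGm; lra). nra. }
  assert (N < / sqrt (4 * D) * RInt I eps m1).
  { apply (Rmult_lt_reg_r (sqrt (4 * D))); [assumption|].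
    rewrite (Rmult_comm (/ _)), Rmult_assoc, Rinv_l, Rmult_1_r by lra. assumption. }
  lra.
Qed.

(** Serves the alternative in which [g] vanishes: [osgood_fun] asks for positivity, so 0 is replaced
    by the larger linear function, whose primitive is [s ^ 2 / 2] and whose integral is a
    logarithm. *)
Lemma osgood_fun_Rmax : osgood_fun (Rmax 0).
Proof.
  apply (osgood_fun_intro _ 1); [lra|intros; apply continuous_Rmax_l| | |].
  - intros s Hs. apply Rmax_left; assumption.
  - intros s Hs. rewrite Rmax_right; lra.
  (* On positive [s], [sqrt (G s) = k * s]. *)
  - set (k := sqrt (/ 2)). assert (Hk : 0 < k) by (apply sqrt_lt_R0; lra).
    apply (filterlim_ext_loc (fun eps => / k * (ln 1 - ln eps))).
    + exists (mkposreal 1 Rlt_0_1). intros eps Heps Hpos.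
      unfold ball in Heps; simpl in Heps; unfold AbsRing_ball, abs, minus, plus, opp in Heps;
        simpl in Heps.
      apply Rabs_def2 in Heps.
      symmetry. rewrite (RInt_ext _ (fun s => / k * / s)).
      * apply is_RInt_unique.
        replace (/ k * (ln 1 - ln eps)) with (minus (/ k * ln 1) (/ k * ln eps))
          by (unfold minus, plus, opp; simpl; ring).
        apply (is_RInt_derive (fun s => / k * ln s)).
        -- intros x. rewrite Rmin_left by lra. intros Hx.
           apply (is_derive_scal ln x (/ k)). apply is_derive_Reals, derivable_pt_lim_ln; lra.
        -- intros x. rewrite Rmin_left by lra. intros Hx.
           apply (continuous_scal_r (/ k) Rinv). apply continuous_Rinv; lra.
      * intros x. rewrite Rmin_left, Rmax_right by lra. intros Hx.
        assert (HR : RInt (Rmax 0) 0 x = x * x * / 2).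
        { rewrite (RInt_ext _ (fun s => s)).
          - apply is_RInt_unique.
            replace (x * x * / 2) with (minus (x ^ 2 / 2) (0 ^ 2 / 2))
              by (unfold minus, plus, opp; simpl; field).
            apply (is_RInt_derive (fun s => s ^ 2 / 2)).
            + intros; auto_derive; [trivial|field].
            + intros; apply continuous_id.
          - intros t. rewrite Rmin_left by lra. intros; apply Rmax_right; lra. }
        rewrite HR, sqrt_mult, sqrt_square by nra. fold k.
        match goal with |- @eq _ ?a ?b => change (@eq R a b) end.
        field. lra.
    + intros P [M HM]. exists (mkposreal _ (exp_pos (- (k * M)))).
      intros eps Heps Hpos.
      unfold ball in Heps; simpl in Heps; unfold AbsRing_ball, abs, minus, plus, opp in Heps;
        simpl in Heps.
      apply Rabs_def2 in Heps. apply HM. rewrite ln_1.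
      assert (ln eps < - (k * M)).
      { rewrite <- (ln_exp (- (k * M))). apply ln_increasing; lra. }
      apply (Rmult_lt_reg_l k); [assumption|].
      replace (k * (/ k * (0 - ln eps))) with (- ln eps) by (field; lra). lra.
Qed.

(** In a window of half-width [delta / 2] the differences [t - s] stay in [[0, delta]]. Hence [g]
    may be replaced by its truncation, constant outside this interval, which is continuous and
    positive on all positive reals. *)
Lemma one_sided_osgood_fun (f : R -> R) (tbar : R) :
  one_sided_osgood f tbar -> exists delta g, 0 < delta /\ osgood_fun g /\
    forall s t, 0 <= s -> tbar - delta <= s -> s <= t -> t <= tbar + delta ->
      f s - f t <= g (t - s).
Proof.
  intros [delta [g [Hd [Hc [H0 [Hf Hg]]]]]].
  destruct Hg as [Hz|[Hp [_ Hdiv]]].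
  - exists (delta / 2), (Rmax 0). split; [lra|]. split; [apply osgood_fun_Rmax|].
    intros s t H1 H2 H3 H4. specialize (Hf s t H1 H2 H3 H4).
    rewrite Hz in Hf by lra. pose proof (Rmax_l 0 (t - s)). lra.
  - set (gt := fun s => g (Rmax 0 (Rmin s delta))).
    assert (Hgt : forall s, 0 <= s <= delta -> gt s = g s).
    { intros s Hs. unfold gt. rewrite Rmin_left, Rmax_right; lra. }
    exists (delta / 2), gt. split; [lra|]. split.
    + apply (osgood_fun_intro gt delta); [assumption| | | |].
      * intros s. apply (continuous_on_comp (fun s => 0 <= s <= delta) g
          (fun s => Rmax 0 (Rmin s delta))).
        -- exact Hc.
        -- intros y. unfold Rmax, Rmin. repeat destruct Rle_dec; lra.
        -- apply (continuous_comp (fun t => Rmin t delta) (Rmax 0)).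
           ++ apply continuous_Rmin_r.
           ++ apply continuous_Rmax_l.
      * intros s Hs. unfold gt. rewrite Rmin_left, Rmax_left by lra. assumption.
      * intros s Hs. apply Hp. unfold Rmax, Rmin. repeat destruct Rle_dec; lra.
      * unfold osgood_integral_diverges in *. revert Hdiv. apply filterlim_ext_loc.
        exists (mkposreal _ Hd). intros eps Heps Hpos.
        unfold ball in Heps; simpl in Heps; unfold AbsRing_ball, abs, minus, plus, opp in Heps;
        simpl in Heps.
        apply Rabs_def2 in Heps. apply RInt_ext.
        intros x. rewrite Rmin_left, Rmax_right by lra. intros Hx.
        do 2 f_equal. apply RInt_ext. intros z. rewrite Rmin_left, Rmax_right by lra.
        intros Hz. symmetry; apply Hgt; lra.
    + intros s t H1 H2 H3 H4. rewrite Hgt by lra. apply Hf; assumption.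
Qed.

(** * Hopf's lemma and the strong comparison principle *)

(** The function is [ln (sqrt D / r)] in one coordinate, the other being frozen in [c]. The second
    derivatives in the two coordinates add up to 0, which is its harmonicity. *)
Lemma derive2_log_radius (c p x D : R) :
  0 < D -> 0 < (x - p) ^ 2 + c ^ 2 ->
  derive2 (fun t => - / 2 * ln (((t - p) ^ 2 + c ^ 2) / D)) x
    (- (x - p) / ((x - p) ^ 2 + c ^ 2))
    (- / ((x - p) ^ 2 + c ^ 2) + 2 * (x - p) ^ 2 / ((x - p) ^ 2 + c ^ 2) ^ 2).
Proof.
  intros HD Hp. exists (fun t => - (t - p) / ((t - p) ^ 2 + c ^ 2)). split; [|split].
  - assert (H : locally x (fun t => 0 < (t - p) ^ 2 + c ^ 2)).
    { apply locally_gt; [cont|assumption]. }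
    generalize H; apply filter_imp. intros t Ht.
    auto_derive.
    + apply Rdiv_lt_0_compat; [simpl in Ht |- *|assumption]. lra.
    + simpl. field. simpl in Ht. repeat split; lra.
  - reflexivity.
  - auto_derive; [simpl in Hp; lra|]. simpl. field. simpl in Hp. repeat split; lra.
Qed.

(* Compare [T w] with the harmonic function [ln (R / r)], where [T] is the
   travel time of [h'' = D g h] from [h = 0], [h' = a]: at an interior critical point of
   the difference, its laplacian is at most [T' g (w) (1 - D / r^2) < 0]. *)
Lemma hopf_disc (w : R * R -> R) (g : R -> R) (px py D : R) :
  0 < D -> osgood_fun g -> (forall p, continuous w p) ->
  (forall x y, (x - px) ^ 2 + (y - py) ^ 2 < D -> 0 < w (x, y)) ->
  (forall x y, (x - px) ^ 2 + (y - py) ^ 2 <= D -> 0 <= w (x, y)) ->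
  (forall x y, 0 < (x - px) ^ 2 + (y - py) ^ 2 < D -> exists d1 d2 e1 e2,
     derive2 (fun t => w (t, y)) x d1 d2 /\ derive2 (fun t => w (x, t)) y e1 e2 /\
     d2 + e2 <= g (w (x, y))) ->
  exists a, 0 < a /\ forall e1 e2 l, e1 ^ 2 + e2 ^ 2 = D -> / 2 <= l <= 1 ->
    a * (1 - l) <= w (px + l * e1, py + l * e2).
Proof.
  intros HD [Hgc [Hg0 [Hgp Hgd]]] Hw Hpos Hnn Hlap.
  set (q := fun p : R * R => (fst p - px) ^ 2 + (snd p - py) ^ 2).
  assert (Hq : forall p, continuous q p) by (intros; unfold q; cont).
  assert (Hqb : forall x y r, 0 < r -> q (x, y) <= r ->
            px - (1 + r) <= x <= px + (1 + r) /\ py - (1 + r) <= y <= py + (1 + r)).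
  { intros x y r Hr. unfold q; simpl fst; simpl snd. intros H.
    pose proof (pow2_ge_0 (x - px)). pose proof (pow2_ge_0 (y - py)).
    pose proof (pow2_ge_0 (x - px - 1)). pose proof (pow2_ge_0 (x - px + 1)).
    pose proof (pow2_ge_0 (y - py - 1)). pose proof (pow2_ge_0 (y - py + 1)).
    split; lra. }
  (* The inner boundary of the annulus, the circle of half the radius, on which [w] has a positive
     minimum [m]. *)
  destruct (compact_min (fun p => D / 4 <= q p /\ q p <= D / 4) w
     (px - (1 + D)) (px + (1 + D)) (py - (1 + D)) (py + (1 + D)))
     as [[mx my] [[Hm1 Hm2] Hmin]].
  { apply closed_and; [apply closed_ge_continuous|apply closed_le_continuous]; assumption. }
  { intros x y [H1 H2]. apply Hqb; lra. }
  { intros; apply Hw. }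
  { exists (px + sqrt (D / 4), py). unfold q; simpl.
    replace (px + sqrt (D / 4) - px) with (sqrt (D / 4)) by ring.
    replace ((py - py) * ((py - py) * 1)) with 0 by ring.
    rewrite Rmult_1_r, sqrt_sqrt by lra. lra. }
  set (m := w (mx, my)) in *.
  assert (Hm : 0 < m) by (apply Hpos; unfold q in Hm2; simpl in *; lra).
  (* [- / 2 * ln (/ 4)] is the value of the logarithm on the inner circle. With this [a], the travel
     time to [m] is at least that value, so [T w] dominates there; on the outer circle the logarithm
     is 0. *)
  destruct (Hgd D m (- / 2 * ln (/ 4)) HD Hm) as [a [Ha HN]].
  pose (G := (fun s => RInt g 0 s) : R -> R).
  set (T1 := fun s => / sqrt (a ^ 2 + 2 * D * G s)).
  pose (T := (fun s => RInt T1 0 s) : R -> R).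
  assert (HG0 : forall s, 0 <= G s) by (intros; apply primitive_nonneg; assumption).
  assert (HGd : forall s, is_derive G s (g s)) by (intros; apply is_derive_primitive; assumption).
  assert (HP : forall s, a ^ 2 <= a ^ 2 + 2 * D * G s).
  { intros s. specialize (HG0 s). assert (0 <= D * G s) by nra. lra. }
  assert (HP0 : forall s, 0 < a ^ 2 + 2 * D * G s).
  { intros s. specialize (HP s). assert (0 < a ^ 2) by nra. lra. }
  assert (HT1p : forall s, 0 < T1 s).
  { intros s. apply Rinv_0_lt_compat, sqrt_lt_R0, HP0. }
  assert (HT1a : forall s, T1 s <= / a).
  { intros s. apply Rinv_le_contravar; [assumption|].
    rewrite <- (sqrt_pow2 a) at 1 by lra. apply sqrt_le_1_alt, HP. }
  assert (HT1d : forall s, is_derive T1 s (- (D * g s * T1 s ^ 3))).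
  { intros s. unfold T1.
    assert (Hs : 0 < sqrt (a ^ 2 + 2 * D * G s)) by apply sqrt_lt_R0, HP0.
    evar_last.
    - apply (is_derive_inv (fun s => sqrt (a ^ 2 + 2 * D * G s))); [|exact (Rgt_not_eq _ _ Hs)].
      apply (is_derive_comp sqrt (fun s => a ^ 2 + 2 * D * G s)).
      + apply is_derive_Reals, derivable_pt_lim_sqrt, HP0.
      + apply (is_derive_plus (fun _ => a ^ 2) (fun s => 2 * D * G s)).
        * apply (is_derive_const (a ^ 2)).
        * apply (is_derive_scal G s (2 * D)). apply HGd.
    - cbv beta. revert Hs. generalize (sqrt (a ^ 2 + 2 * D * G s)). intros Q HQ.
      unfold scal, plus, zero; simpl; unfold mult; simpl. field. lra. }
  assert (HT1c : forall s, continuous T1 s).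
  { intros s. exact (continuous_is_derive _ _ _ (HT1d s)). }
  assert (HTd : forall s, is_derive T s (T1 s)) by (intros; apply is_derive_primitive; assumption).
  assert (HTc : forall s, continuous T s).
  { intros s. exact (continuous_is_derive _ _ _ (HTd s)). }
  assert (HT0 : T 0 = 0) by (unfold T; rewrite RInt_point; reflexivity).
  assert (HTmono : forall s t, s <= t -> T s <= T t).
  { intros s t Hst. unfold T.
    rewrite <- (RInt_Chasles T1 0 s t) by (apply ex_RInt_everywhere_continuous; assumption).
    assert (0 <= RInt T1 s t).
    { apply RInt_ge_0; [assumption|apply ex_RInt_everywhere_continuous; assumption|].
      intros; left; apply HT1p. }
    unfold plus; simpl. lra. }
  assert (HTa : forall s, 0 <= s -> T s <= s * / a).
  { intros s Hs. unfold T. replace (s * / a) with (RInt (fun _ => / a) 0 s).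
    - apply RInt_le; [assumption|apply ex_RInt_everywhere_continuous; assumption| |].
      + apply ex_RInt_const.
      + intros; apply HT1a.
    - rewrite RInt_const. unfold scal; simpl; unfold mult; simpl. ring. }
  set (psi := fun p : R * R => - / 2 * ln (q p / D)).
  assert (Hpsi : forall p, 0 < q p -> continuous psi p).
  { intros p Hp. unfold psi. cont. apply (continuous_comp (fun p => q p / D) ln).
    - unfold Rdiv; cont; apply Hq.
    - apply continuous_ln. apply Rdiv_lt_0_compat; assumption. }
  destruct (compact_min (fun p => D / 4 <= q p /\ q p <= D)
     (fun p => T (w p) - psi p)
     (px - (1 + D)) (px + (1 + D)) (py - (1 + D)) (py + (1 + D)))
     as [[ux uy] [[Hu1 Hu2] Humin]].
  { apply closed_and; [apply closed_ge_continuous|apply closed_le_continuous]; assumption. }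
  { intros x y [H1 H2]. apply Hqb; lra. }
  { intros p [H1 H2]. apply (continuous_Rminus (fun p => T (w p)) psi).
    - apply (continuous_comp w T); [apply Hw|apply HTc].
    - apply Hpsi; lra. }
  { exists (mx, my). lra. }
  assert (Hmain : 0 <= T (w (ux, uy)) - psi (ux, uy)).
  { destruct (Req_dec (q (ux, uy)) D) as [HqD|HqD].
    { unfold psi. rewrite HqD. unfold Rdiv; rewrite Rinv_r, ln_1 by lra.
      assert (0 <= w (ux, uy)) by (apply Hnn; unfold q in Hu2; simpl in *; lra).
      assert (T 0 <= T (w (ux, uy))) by (apply HTmono; assumption). lra. }
    destruct (Req_dec (q (ux, uy)) (D / 4)) as [Hq4|Hq4].
    { unfold psi. rewrite Hq4. replace (D / 4 / D) with (/ 4) by (field; lra).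
      assert (m <= w (ux, uy)) by (apply Hmin; lra).
      assert (T m <= T (w (ux, uy))) by (apply HTmono; assumption).
      unfold T, T1, G in *. lra. }
    exfalso.
    assert (Hqs : D / 4 < q (ux, uy) < D) by lra.
    assert (Hqu : q (ux, uy) = (ux - px) ^ 2 + (uy - py) ^ 2) by reflexivity.
    destruct (Hlap ux uy) as [d1 [d2 [e1 [e2 [Hx [Hy Hle]]]]]]; [lra|].
    assert (Hwp : 0 < w (ux, uy)) by (apply Hpos; lra).
    set (W := w (ux, uy)) in *.
    assert (Fx := derive2_minus _ _ _ _ _ _ _
       (derive2_comp T T1 (fun t => w (t, uy)) ux _ _ _ HTd (HT1d _) Hx)
       (derive2_log_radius (uy - py) px ux D HD ltac:(lra))).
    assert (Fy := derive2_minus _ _ _ _ _ _ _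
       (derive2_comp T T1 (fun t => w (ux, t)) uy _ _ _ HTd (HT1d _) Hy)
       (derive2_log_radius (ux - px) py uy D HD ltac:(lra))).
    cbv beta in Fx, Fy. fold W in Fx, Fy.
    apply derive2_local_min in Fx.
    2:{ assert (Hl : locally ux (fun t => D / 4 < q (t, uy) /\ q (t, uy) < D)).
        { apply filter_and; [apply locally_gt|apply locally_lt];
            [|exact (proj1 Hqs)| |exact (proj2 Hqs)]; unfold q; simpl fst; simpl snd; cont. }
        generalize Hl; apply filter_imp. intros t [Ht1 Ht2].
        assert (Hmn := Humin (t, uy) ltac:(lra)). exact Hmn. }
    apply derive2_local_min in Fy.
    2:{ assert (Hl : locally uy (fun t => D / 4 < q (ux, t) /\ q (ux, t) < D)).
        { apply filter_and; [apply locally_gt|apply locally_lt];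
            [|exact (proj1 Hqs)| |exact (proj2 Hqs)]; unfold q; simpl fst; simpl snd; cont. }
        generalize Hl; apply filter_imp. intros t [Ht1 Ht2].
        assert (Hmn := Humin (ux, t) ltac:(lra)).
        unfold psi, q in Hmn; simpl in Hmn. fold W.
        rewrite (Rplus_comm ((uy - py) ^ 2)), (Rplus_comm ((t - py) ^ 2)). exact Hmn. }
    rewrite (Rplus_comm ((uy - py) ^ 2) ((ux - px) ^ 2)), <- Hqu in Fy.
    rewrite <- Hqu in Fx.
    set (Q := q (ux, uy)) in *. set (t1 := T1 W) in *.
    assert (Ht1 : 0 < t1) by apply HT1p.
    destruct Fx as [Fx1 Fx2]. destruct Fy as [Fy1 Fy2].
    assert (HQ : 0 < Q) by lra.
    assert (Hgw : 0 < g W) by (apply Hgp; assumption).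
    assert (E1 : t1 * d1 = - (ux - px) * / Q) by (unfold Rdiv in Fx1; lra).
    assert (E2 : t1 * e1 = - (uy - py) * / Q) by (unfold Rdiv in Fy1; lra).
    (* At a critical point of the difference the gradients of [T w] and of the logarithm coincide,
       and the latter has norm [1 / r]. *)
    assert (E : t1 ^ 2 * (d1 ^ 2 + e1 ^ 2) = / Q).
    { replace (t1 ^ 2 * (d1 ^ 2 + e1 ^ 2)) with ((t1 * d1) ^ 2 + (t1 * e1) ^ 2) by ring.
      rewrite E1, E2. replace ((- (ux - px) * / Q) ^ 2 + (- (uy - py) * / Q) ^ 2)
        with (((ux - px) ^ 2 + (uy - py) ^ 2) * / Q * / Q) by ring.
      rewrite <- Hqu. field. lra. }
    assert (S0 : 0 <= - (D * g W * t1 ^ 3) * (d1 ^ 2 + e1 ^ 2) + t1 * (d2 + e2)).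
    { assert (Z : - / Q + 2 * (ux - px) ^ 2 / Q ^ 2 + (- / Q + 2 * (uy - py) ^ 2 / Q ^ 2) = 0).
      { replace (- / Q + 2 * (ux - px) ^ 2 / Q ^ 2 + (- / Q + 2 * (uy - py) ^ 2 / Q ^ 2))
          with (- 2 / Q + 2 * ((ux - px) ^ 2 + (uy - py) ^ 2) / Q ^ 2) by (field; lra).
        rewrite <- Hqu. field; lra. }
      lra. }
    replace (- (D * g W * t1 ^ 3) * (d1 ^ 2 + e1 ^ 2))
      with (- (D * g W * t1 * (t1 ^ 2 * (d1 ^ 2 + e1 ^ 2)))) in S0 by ring.
    rewrite E in S0.
    assert (S1 : t1 * (d2 + e2) <= t1 * g W) by (apply Rmult_le_compat_l; lra).
    (* The constant of the differential equation was taken to be the squared radius [D] for this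
       step: [D / Q > 1] inside the disc. *)
    assert (S2 : t1 * g W < D * g W * t1 * / Q).
    { assert (1 < D * / Q).
      { apply (Rmult_lt_reg_r Q); [assumption|]. rewrite Rmult_assoc, Rinv_l; lra. }
      assert (0 < t1 * g W) by (apply Rmult_lt_0_compat; assumption). nra. }
    lra. }
  exists a. split; [assumption|]. intros e1 e2 l He Hl.
  set (p := (px + l * e1, py + l * e2)).
  assert (Hqp : q p = l ^ 2 * D).
  { unfold q, p; simpl. rewrite <- He. ring. }
  assert (Hmn := Humin p). simpl in Hmn.
  assert (HK : D / 4 <= q p /\ q p <= D) by (rewrite Hqp; assert (/ 4 <= l ^ 2 <= 1) by nra; split; nra).
  specialize (Hmn HK).
  assert (Hwn : 0 <= w p).
  { apply Hnn. destruct HK as [_ HK]. unfold q, p in HK; simpl in HK |- *. lra. }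
  (* Since [ln l <= l - 1], the logarithm grows at least linearly from the outer circle; since
     [T w <= w / a], so does [w]. *)
  assert (Hpsip : 1 - l <= psi p).
  { unfold psi. rewrite Hqp. replace (l ^ 2 * D / D) with (l * l) by (field; lra).
    rewrite ln_mult by lra. assert (ln l <= l - 1); [|lra].
    pose proof (exp_ineq1_le (ln l)). rewrite exp_ln in H by lra. lra. }
  assert (HTw := HTa (w p) Hwn).
  assert (Hfin : 1 - l <= w p * / a) by lra.
  apply (Rmult_le_compat_l a) in Hfin; [|lra].
  replace (a * (w p * / a)) with (w p) in Hfin by (field; lra). exact Hfin.
Qed.

Definition semilinear_at (f : R -> R) (u : R * R -> R) (x y : R) : Prop :=
  exists d1 d2 e1 e2, derive2 (fun t => u (t, y)) x d1 d2 /\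
    derive2 (fun t => u (x, t)) y e1 e2 /\ - (d2 + e2) = f (u (x, y)).

Lemma Rabs_le_of_sq (a b : R) : 0 <= b -> a ^ 2 <= b ^ 2 -> Rabs a <= b.
Proof.
  intros Hb H. rewrite <- (Rabs_pos_eq b) by assumption.
  apply Rsqr_le_abs_0. unfold Rsqr; lra.
Qed.

(** Osgood's condition is available only near the common value at the touching point. [hopf_disc] is
    therefore applied to [v - u] in a smaller disc, internally tangent there, on which both
    functions stay within [delta] of that value. *)
Lemma hopf_touching (f : R -> R) (u v : R * R -> R) (px py ex ey : R) :
  0 < ex ^ 2 + ey ^ 2 -> (forall p, continuous u p) -> (forall p, continuous v p) ->
  one_sided_osgood f (u (px + ex, py + ey)) ->
  u (px + ex, py + ey) = v (px + ex, py + ey) ->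
  (forall x y, (x - px) ^ 2 + (y - py) ^ 2 <= ex ^ 2 + ey ^ 2 ->
     0 <= u (x, y) <= v (x, y)) ->
  (forall x y, (x - px) ^ 2 + (y - py) ^ 2 < ex ^ 2 + ey ^ 2 ->
     semilinear_at f u x y /\ semilinear_at f v x y /\ u (x, y) < v (x, y)) ->
  exists a l0, 0 < a /\ l0 < 1 /\ forall l, l0 <= l <= 1 ->
    a * (1 - l) <= v (px + l * ex, py + l * ey) - u (px + l * ex, py + l * ey).
Proof.
  intros HE Hu Hv Hosg Heq Hle Hin.
  destruct (one_sided_osgood_fun _ _ Hosg) as [delta [g [Hdelta [Hg Hfg]]]].
  set (E := ex ^ 2 + ey ^ 2) in *.
  set (qx := px + ex) in *. set (qy := py + ey) in *.
  destruct (continuous_pair_eps u qx qy (Hu _) delta Hdelta) as [d1 [Hd1 Hc1]].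
  destruct (continuous_pair_eps v qx qy (Hv _) delta Hdelta) as [d2 [Hd2 Hc2]].
  set (d := Rmin d1 d2). assert (Hd : 0 < d) by (apply Rmin_glb_lt; assumption).
  assert (Hdd1 : d <= d1) by apply Rmin_l. assert (Hdd2 : d <= d2) by apply Rmin_r.
  set (M := 1 + E).
  assert (HM : E <= M ^ 2) by (unfold M; nra).
  assert (HMx : Rabs ex <= M).
  { apply Rabs_le_of_sq; [unfold M; lra|]. pose proof (pow2_ge_0 ey). unfold E in *; lra. }
  assert (HMy : Rabs ey <= M).
  { apply Rabs_le_of_sq; [unfold M; lra|]. pose proof (pow2_ge_0 ex). unfold E in *; lra. }
  assert (HM0 : 0 < M) by (unfold M; lra).
  (* Ratio of the two radii. Coordinates in the small disc differ from those of the touching point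
     by at most [2 * (k * M) < d]. *)
  set (k := Rmin (/ 2) (d / (4 * M))).
  assert (Hk : 0 < k <= / 2).
  { unfold k. split; [|apply Rmin_l]. apply Rmin_glb_lt; [lra|].
    apply Rdiv_lt_0_compat; lra. }
  assert (HkM : 2 * (k * M) < d).
  { assert (k <= d / (4 * M)) by apply Rmin_r.
    assert (k * M <= d / (4 * M) * M) by (apply Rmult_le_compat_r; lra).
    replace (d / (4 * M) * M) with (d / 4) in H0 by (field; lra). lra. }
  set (cx := px + (1 - k) * ex). set (cy := py + (1 - k) * ey).
  (* Convexity of the squared norm at [k * (A / k) + (1 - k) * e], cleared of denominators; it
     places the small disc inside the large one. *)
  assert (Hconv : forall x y, (x - cx) ^ 2 + (y - cy) ^ 2 <= k ^ 2 * E ->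
      k * (1 - k) * ((x - px) ^ 2 + (y - py) ^ 2) <=
      (1 - k) * ((x - cx) ^ 2 + (y - cy) ^ 2) + k * (1 - k) ^ 2 * E).
  { intros x y _. set (A := x - cx). set (B := y - cy).
    replace (x - px) with (A + (1 - k) * ex) by (unfold A, cx; ring).
    replace (y - py) with (B + (1 - k) * ey) by (unfold B, cy; ring).
    pose proof (pow2_ge_0 ((1 - k) * A - k * (1 - k) * ex)).
    pose proof (pow2_ge_0 ((1 - k) * B - k * (1 - k) * ey)).
    unfold E. nra. }
  assert (Hball : forall x y, (x - cx) ^ 2 + (y - cy) ^ 2 < k ^ 2 * E ->
      (x - px) ^ 2 + (y - py) ^ 2 < E).
  { intros x y H. assert (H1 := Hconv x y (Rlt_le _ _ H)).
    apply (Rmult_lt_reg_l (k * (1 - k))); [nra|].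
    assert ((1 - k) * ((x - cx) ^ 2 + (y - cy) ^ 2) < (1 - k) * (k ^ 2 * E))
      by (apply Rmult_lt_compat_l; lra).
    assert ((1 - k) * (k ^ 2 * E) + k * (1 - k) ^ 2 * E = k * (1 - k) * E) by ring.
    lra. }
  assert (Hcball : forall x y, (x - cx) ^ 2 + (y - cy) ^ 2 <= k ^ 2 * E ->
      (x - px) ^ 2 + (y - py) ^ 2 <= E).
  { intros x y H. assert (H1 := Hconv x y H).
    apply (Rmult_le_reg_l (k * (1 - k))); [nra|].
    assert ((1 - k) * ((x - cx) ^ 2 + (y - cy) ^ 2) <= (1 - k) * (k ^ 2 * E))
      by (apply Rmult_le_compat_l; lra).
    assert ((1 - k) * (k ^ 2 * E) + k * (1 - k) ^ 2 * E = k * (1 - k) * E) by ring.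
    lra. }
  assert (Hnear : forall x y, (x - cx) ^ 2 + (y - cy) ^ 2 <= k ^ 2 * E ->
      Rabs (x - qx) < d /\ Rabs (y - qy) < d).
  { intros x y H.
    assert (HkM2 : k ^ 2 * E <= (k * M) ^ 2) by nra.
    assert (Hx : Rabs (x - cx) <= k * M).
    { apply Rabs_le_of_sq; [nra|]. pose proof (pow2_ge_0 (y - cy)); lra. }
    assert (Hy : Rabs (y - cy) <= k * M).
    { apply Rabs_le_of_sq; [nra|]. pose proof (pow2_ge_0 (x - cx)); lra. }
    assert (Hkx : Rabs (k * ex) <= k * M).
    { rewrite Rabs_mult, (Rabs_pos_eq k) by lra. apply Rmult_le_compat_l; lra. }
    assert (Hky : Rabs (k * ey) <= k * M).
    { rewrite Rabs_mult, (Rabs_pos_eq k) by lra. apply Rmult_le_compat_l; lra. }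
    apply Rabs_le_between in Hx. apply Rabs_le_between in Hy.
    apply Rabs_le_between in Hkx. apply Rabs_le_between in Hky.
    unfold cx, cy, qx, qy in *. split; apply Rabs_def1; lra. }
  destruct (hopf_disc (fun p => v p - u p) g cx cy (k ^ 2 * E)) as [a [Ha Hl]].
  - apply Rmult_lt_0_compat; [apply pow_lt; lra|assumption].
  - assumption.
  - intros p. cont; auto.
  - intros x y H. destruct (Hin x y (Hball x y H)) as [_ [_ H3]]. lra.
  - intros x y H. destruct (Hle x y (Hcball x y H)). lra.
  - intros x y [_ H].
    destruct (Hin x y (Hball x y H)) as [[a1 [a2 [a3 [a4 [A1 [A2 A3]]]]]]
      [[b1 [b2 [b3 [b4 [B1 [B2 B3]]]]]] H3]].
    destruct (Hle x y (Hcball x y (Rlt_le _ _ H))) as [Hp _].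
    destruct (Hnear x y (Rlt_le _ _ H)) as [Hn1 Hn2].
    exists (b1 - a1), (b2 - a2), (b3 - a3), (b4 - a4). split; [|split].
    + apply derive2_minus; assumption.
    + apply derive2_minus; assumption.
    + assert (N1 := Hc1 x y ltac:(lra) ltac:(lra)).
      assert (N2 := Hc2 x y ltac:(lra) ltac:(lra)).
      apply Rabs_def2 in N1. apply Rabs_def2 in N2. rewrite <- Heq in N2.
      assert (F := Hfg (u (x, y)) (v (x, y)) Hp ltac:(lra) ltac:(lra) ltac:(lra)). lra.
  (* The parameter [l] on the large radius is [1 - (1 - l) / k] on the small one; [l >= 1 - k / 2]
     keeps the latter above one half. *)
  - exists (a / k), (1 - k / 2). split; [apply Rdiv_lt_0_compat; lra|]. split; [lra|].
    intros l Hl0.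
    specialize (Hl (k * ex) (k * ey) (1 - (1 - l) / k)).
    replace (cx + (1 - (1 - l) / k) * (k * ex)) with (px + l * ex) in Hl
      by (unfold cx; field; lra).
    replace (cy + (1 - (1 - l) / k) * (k * ey)) with (py + l * ey) in Hl
      by (unfold cy; field; lra).
    replace (a * (1 - (1 - (1 - l) / k))) with (a / k * (1 - l)) in Hl by (field; lra).
    apply Hl; [unfold E; ring|].
    assert (0 <= (1 - l) / k <= / 2); [|lra].
    split; [apply Rdiv_le_0_compat; lra|].
    apply (Rmult_le_reg_r k); [lra|]. unfold Rdiv. rewrite Rmult_assoc, Rinv_l; lra.
Qed.

(** Descending vertical segments replace connectedness of [Om]: each ends at a point of the axis
    where the inequality is strict, so a contact has a lowest one on its segment. A disc hanging
    below that contact then leads to a point where Hopf's lemma contradicts interior minimality of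
    [v - u]. *)
Lemma strong_comparison (f : R -> R) (u v : R * R -> R) (Om : R * R -> Prop) :
  open Om -> (forall p, continuous u p) -> (forall p, continuous v p) ->
  (forall x y, Om (x, y) -> semilinear_at f u x y /\ semilinear_at f v x y /\
     0 <= u (x, y) <= v (x, y) /\ one_sided_osgood f (u (x, y))) ->
  (forall x y e1 e2, Om (x, y) ->
     ex_derive (fun t => v (x + t * e1, y + t * e2) - u (x + t * e1, y + t * e2)) 0) ->
  (forall x y, Om (x, y) -> 0 < y /\ u (x, 0) < v (x, 0) /\
     forall y', 0 < y' <= y -> Om (x, y')) ->
  forall x y, Om (x, y) -> u (x, y) < v (x, y).
Proof.
  intros Hop Hu Hv Hsol Hder Hdown x1 y1 Hp.
  apply Rnot_le_lt; intros Hbad.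
  set (w := fun p => v p - u p).
  assert (Hw : forall p, continuous w p) by (intros; unfold w; cont; auto).
  destruct (Hdown _ _ Hp) as [Hy1 [Hbot Hdn]].
  (* first zero of [w] above the bottom of the vertical segment *)
  destruct (compact_min (fun p => (x1 <= fst p /\ fst p <= x1) /\
      (0 <= snd p /\ snd p <= y1) /\ w p <= 0) snd x1 x1 0 y1)
    as [[x0 y0] [[[Hx0 Hx0'] [[Hy0 Hy0'] Hw0]] Hmin]].
  { repeat apply closed_and;
      (apply closed_ge_continuous || apply closed_le_continuous); intros; cont; auto. }
  { simpl; tauto. }
  { intros; cont. }
  { exists (x1, y1). unfold w; simpl. lra. }
  simpl in *. assert (x0 = x1) by lra. subst x0.
  assert (Hy0p : 0 < y0).
  { destruct (Req_dec y0 0) as [->|]; [|lra]. unfold w in Hw0. lra. }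
  assert (Hfirst : forall y, 0 <= y < y0 -> 0 < w (x1, y)).
  { intros y Hy. apply Rnot_le_lt; intros Hc. specialize (Hmin (x1, y)). simpl in Hmin.
    assert (y0 <= y) by (apply Hmin; lra). lra. }
  assert (HOm0 : Om (x1, y0)) by (apply Hdn; lra).
  destruct (Hop _ HOm0) as [rho Hrho].
  (* The disc of radius [r] about [(x1, y0 - r)] passes through the contact, lies in [Om], and has
     its centre where [w > 0]. *)
  set (r := Rmin (rho / 2) y0 / 2).
  assert (Hr : 0 < r /\ r < y0 /\ 4 * r <= rho).
  { assert (0 < rho / 2) by (pose proof (cond_pos rho); lra).
    pose proof (Rmin_glb_lt _ _ _ H Hy0p). pose proof (Rmin_l (rho / 2) y0).
    pose proof (Rmin_r (rho / 2) y0). unfold r; lra. }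
  set (zy := y0 - r).
  set (q := fun p : R * R => (fst p - x1) ^ 2 + (snd p - zy) ^ 2).
  assert (Hqc : forall p, continuous q p) by (intros; unfold q; cont).
  assert (Hqin : forall x y, q (x, y) <= r ^ 2 ->
     Rabs (x - x1) <= r /\ Rabs (y - zy) <= r).
  { intros x y H. unfold q in H; simpl fst in H; simpl snd in H.
    pose proof (pow2_ge_0 (x - x1)). pose proof (pow2_ge_0 (y - zy)).
    split; apply Rabs_le_of_sq; lra. }
  assert (HqOm : forall x y, q (x, y) <= r ^ 2 -> Om (x, y)).
  { intros x y H. destruct (Hqin x y H) as [A B].
    apply Rabs_le_between in A. apply Rabs_le_between in B. unfold zy in B.
    apply Hrho. split; unfold ball; simpl; unfold AbsRing_ball, abs, minus, plus, opp; simpl;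
      pose proof (cond_pos rho); apply Rabs_def1; lra. }
  assert (Hwz : 0 < w (x1, zy)) by (apply Hfirst; unfold zy; lra).
  (* The zero of [w] nearest to the centre: the open disc up to it is free of zeros, as
     [hopf_touching] requires. *)
  destruct (compact_min (fun p => q p <= r ^ 2 /\ w p <= 0) q
     (x1 - r) (x1 + r) (zy - r) (zy + r)) as [[qx qy] [[Hq1 Hq2] Hqmin]].
  { apply closed_and; apply closed_le_continuous; assumption. }
  { intros x y [H _]. destruct (Hqin x y H) as [A B].
    apply Rabs_le_between in A. apply Rabs_le_between in B. lra. }
  { intros; apply Hqc. }
  { exists (x1, y0). split; [|assumption]. unfold q, zy; simpl. right; ring. }
  assert (HqO : Om (qx, qy)) by (apply HqOm; assumption).
  set (E := q (qx, qy)) in *.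
  assert (HE : 0 < E).
  { destruct (Rle_lt_dec E 0) as [Hc|]; [exfalso|assumption].
    unfold E, q in Hc; simpl fst in Hc; simpl snd in Hc.
    pose proof (pow2_ge_0 (qx - x1)). pose proof (pow2_ge_0 (qy - zy)).
    assert (qx - x1 = 0) by (apply Rsqr_0_uniq; unfold Rsqr; lra).
    assert (qy - zy = 0) by (apply Rsqr_0_uniq; unfold Rsqr; lra).
    replace qx with x1 in Hq2 by lra. replace qy with zy in Hq2 by lra. lra. }
  destruct (hopf_touching f u v x1 zy (qx - x1) (qy - zy)) as [a [l0 [Ha [Hl0 Hhopf]]]].
  - exact HE.
  - assumption.
  - assumption.
  - replace (x1 + (qx - x1)) with qx by ring. replace (zy + (qy - zy)) with qy by ring.
    apply Hsol; assumption.
  - replace (x1 + (qx - x1)) with qx by ring. replace (zy + (qy - zy)) with qy by ring.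
    destruct (Hsol _ _ HqO) as [_ [_ [Hc _]]]. unfold w in Hq2. lra.
  - intros x y H. apply Hsol, HqOm. change (q (x, y) <= E) in H. lra.
  - intros x y H. change (q (x, y) < E) in H.
    destruct (Hsol x y) as [A [B [C _]]]; [apply HqOm; lra|].
    split; [assumption|split; [assumption|]].
    apply Rnot_le_lt; intros Hc. specialize (Hqmin (x, y)).
    assert (E <= q (x, y)); [|lra]. apply Hqmin. unfold w. lra.
  - set (e1 := x1 - qx). set (e2 := zy - qy).
    destruct (Hder qx qy e1 e2 HqO) as [d Hd].
    set (phi := fun t => v (qx + t * e1, qy + t * e2) - u (qx + t * e1, qy + t * e2)) in Hd.
    assert (Hphi0 : phi 0 = 0).
    { unfold phi. replace (qx + 0 * e1) with qx by ring. replace (qy + 0 * e2) with qy by ring.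
      destruct (Hsol _ _ HqO) as [_ [_ [Hc _]]]. unfold w in Hq2. lra. }
    assert (Hd0 : d = 0).
    { apply (is_derive_local_min phi 0); [assumption|].
      assert (Hl : locally 0 (fun t => Om (qx + t * e1, qy + t * e2))).
      { assert (C : continuous (fun t => (qx + t * e1, qy + t * e2)) 0) by cont.
        apply C. replace (qx + 0 * e1) with qx by ring.
        replace (qy + 0 * e2) with qy by ring. apply Hop; assumption. }
      generalize Hl; apply filter_imp. intros t Ht. rewrite Hphi0. unfold phi.
      destruct (Hsol _ _ Ht) as [_ [_ [Hc _]]]. lra. }
    subst d. assert (a <= 0); [|lra].
    apply (derive_ge_slope phi 0 a (1 - l0) Hd); [lra|].
    intros t Ht. rewrite Hphi0.
    assert (H := Hhopf (1 - t) ltac:(lra)).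
    replace (x1 + (1 - t) * (qx - x1)) with (qx + t * e1) in H by (unfold e1; ring).
    replace (zy + (1 - t) * (qy - zy)) with (qy + t * e2) in H by (unfold e2; ring).
    change (a * (1 - (1 - t)) <= phi t) in H. lra.
Qed.

(** * Reflections and triangles *)

(* [du_xy] is the [y]-derivative of [du_x], and [du_yx] the [x]-derivative of
   [du_y]; all functions are extended continuously below the axis. *)
Record half_plane_solution (f : R -> R) : Type := {
  sol : R * R -> R;
  du_x : R * R -> R; du_y : R * R -> R;
  du_xx : R * R -> R; du_xy : R * R -> R; du_yx : R * R -> R; du_yy : R * R -> R;
  sol_cont : forall p, continuous sol p;
  du_x_cont : forall p, continuous du_x p;
  du_y_cont : forall p, continuous du_y p;
  du_xx_cont : forall p, continuous du_xx p;
  du_xy_cont : forall p, continuous du_xy p;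
  du_yx_cont : forall p, continuous du_yx p;
  du_yy_cont : forall p, continuous du_yy p;
  sol_dx : forall x y, 0 < y -> is_derive (fun t => sol (t, y)) x (du_x (x, y));
  sol_dy : forall x y, 0 < y -> is_derive (fun t => sol (x, t)) y (du_y (x, y));
  du_x_dx : forall x y, 0 < y -> is_derive (fun t => du_x (t, y)) x (du_xx (x, y));
  du_x_dy : forall x y, 0 < y -> is_derive (fun t => du_x (x, t)) y (du_xy (x, y));
  du_y_dx : forall x y, 0 < y -> is_derive (fun t => du_y (t, y)) x (du_yx (x, y));
  du_y_dy : forall x y, 0 < y -> is_derive (fun t => du_y (x, t)) y (du_yy (x, y));
  sol_eq : forall x y, 0 < y -> - (du_xx (x, y) + du_yy (x, y)) = f (sol (x, y));
  sol_pos : forall x y, 0 < y -> 0 < sol (x, y);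
  sol_bottom : forall x, sol (x, 0) = 0
}.

Arguments sol {f}. Arguments du_x {f}. Arguments du_y {f}. Arguments du_xx {f}.
Arguments du_xy {f}. Arguments du_yx {f}. Arguments du_yy {f}.

Lemma sol_nonneg (f : R -> R) (S : half_plane_solution f) (x y : R) :
  0 <= y -> 0 <= sol S (x, y).
Proof.
  intros Hy. destruct (Req_dec y 0) as [->|].
  - rewrite sol_bottom; lra.
  - left; apply sol_pos; lra.
Qed.

(** Two partial derivatives, one of them continuous, give differentiability, hence the chain
    rule. *)
Lemma is_derive_along_line (H Hx Hy : R * R -> R) (a b al be t0 : R) :
  0 < b + be * t0 -> (forall p, continuous Hx p) ->
  (forall x y, 0 < y -> is_derive (fun t => H (t, y)) x (Hx (x, y))) ->
  (forall x y, 0 < y -> is_derive (fun t => H (x, t)) y (Hy (x, y))) ->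
  is_derive (fun t => H (a + al * t, b + be * t)) t0
    (al * Hx (a + al * t0, b + be * t0) + be * Hy (a + al * t0, b + be * t0)).
Proof.
  intros Hpos Hc HHx HHy.
  set (x := a + al * t0). set (y := b + be * t0).
  assert (D : differentiable_pt_lim (fun x y => H (x, y)) x y (Hx (x, y)) (Hy (x, y))).
  { apply filterdiff_differentiable_pt_lim.
    apply (is_derive_filterdiff (fun x y => H (x, y)) x y (fun x y => Hx (x, y))).
    - assert (L : locally (x, y) (fun p : R * R => 0 < snd p)).
      { apply locally_gt; [cont|exact Hpos]. }
      generalize L; apply filter_imp. intros p Hp. apply HHx; assumption.
    - apply HHy; assumption.
    - apply (continuous_ext Hx); [intros [? ?]; reflexivity|apply Hc]. }
  apply is_derive_Reals.
  replace (al * Hx (x, y) + be * Hy (x, y)) with (Hx (x, y) * al + Hy (x, y) * be) by ring.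
  apply (derivable_pt_lim_comp_2d (fun x y => H (x, y))
           (fun t => a + al * t) (fun t => b + be * t)).
  - exact D.
  - apply is_derive_Reals. auto_derive; [trivial|unfold Rminus; ring].
  - apply is_derive_Reals. auto_derive; [trivial|unfold Rminus; ring].
Qed.

(** On a horizontal or vertical line the reflected function is [sol] on a slanted one, hence the
    need for general directions. *)
Lemma derive2_along_line (f : R -> R) (S : half_plane_solution f) (a b al be t0 : R) :
  0 < b + be * t0 ->
  derive2 (fun t => sol S (a + al * t, b + be * t)) t0
    (al * du_x S (a + al * t0, b + be * t0) + be * du_y S (a + al * t0, b + be * t0))
    (al * (al * du_xx S (a + al * t0, b + be * t0) + be * du_xy S (a + al * t0, b + be * t0)) +
     be * (al * du_yx S (a + al * t0, b + be * t0) + be * du_yy S (a + al * t0, b + be * t0))).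
Proof.
  intros Hpos.
  exists (fun t => al * du_x S (a + al * t, b + be * t) + be * du_y S (a + al * t, b + be * t)).
  split; [|split].
  - assert (L : locally t0 (fun t => 0 < b + be * t)).
    { apply locally_gt; [cont|exact Hpos]. }
    generalize L; apply filter_imp. intros t Ht.
    apply is_derive_along_line; [assumption| | |].
    + apply du_x_cont.
    + apply sol_dx.
    + apply sol_dy.
  - reflexivity.
  - apply (is_derive_plus (fun t => al * du_x S (a + al * t, b + be * t))
             (fun t => be * du_y S (a + al * t, b + be * t))).
    + apply (is_derive_scal (fun t => du_x S (a + al * t, b + be * t)) t0 al).
      apply is_derive_along_line;
        [assumption|apply du_xx_cont|apply du_x_dx|apply du_x_dy].
    + apply (is_derive_scal (fun t => du_y S (a + al * t, b + be * t)) t0 be).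
      apply is_derive_along_line;
        [assumption|apply du_yx_cont|apply du_y_dx|apply du_y_dy].
Qed.

Lemma semilinear_sol (f : R -> R) (S : half_plane_solution f) (x y : R) :
  0 < y -> semilinear_at f (sol S) x y.
Proof.
  intros Hy.
  assert (A := derive2_along_line f S 0 y 1 0 x ltac:(lra)).
  assert (B := derive2_along_line f S x 0 0 1 y ltac:(lra)).
  cbv beta in A, B.
  do 4 eexists. split; [|split].
  - eapply derive2_ext; [|exact A]. intros t; simpl. f_equal; f_equal; ring.
  - eapply derive2_ext; [|exact B]. intros t; simpl. f_equal; f_equal; ring.
  - replace (0 + 1 * x) with x by ring. replace (y + 0 * x) with y by ring.
    replace (x + 0 * y) with x by ring. replace (0 + 1 * y) with y by ring.
    rewrite <- (sol_eq f S) by assumption. ring.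
Qed.

(* Reflection across the line of slope [tau] through [(x0, s)]. *)
Definition reflect (tau x0 s : R) (p : R * R) : R * R :=
  let e := snd p - s - tau * (fst p - x0) in
  let k := 2 / (1 + tau ^ 2) in
  (fst p + k * tau * e, snd p - k * e).

Definition reflected {f : R -> R} (S : half_plane_solution f) (tau x0 s : R) (p : R * R) : R :=
  sol S (reflect tau x0 s p).

Lemma continuous_reflect (tau x0 s : R) (p : R * R) : continuous (reflect tau x0 s) p.
Proof. unfold reflect. cont. Qed.

Lemma continuous_reflected (f : R -> R) (S : half_plane_solution f) (tau x0 s : R) (p : R * R) :
  continuous (reflected S tau x0 s) p.
Proof.
  apply (continuous_comp (reflect tau x0 s) (sol S)).
  - apply continuous_reflect.
  - apply sol_cont.
Qed.

(** A point below the line is moved along the upward normal [(- tau, 1)]. In particular triangles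
    are reflected into the half-plane, where the equation and the sign of [sol] are known. *)
Lemma reflect_height (tau x0 s x y : R) :
  y - s - tau * (x - x0) <= 0 -> y <= snd (reflect tau x0 s (x, y)).
Proof.
  intros H. unfold reflect; simpl.
  assert (0 < 2 / (1 + tau ^ 2)) by (apply Rdiv_lt_0_compat; nra).
  simpl in H0. nra.
Qed.

Lemma reflect_height_lt (tau x0 s x y : R) :
  y - s - tau * (x - x0) < 0 -> y < snd (reflect tau x0 s (x, y)).
Proof.
  intros H. unfold reflect; simpl.
  assert (0 < 2 / (1 + tau ^ 2)) by (apply Rdiv_lt_0_compat; nra).
  simpl in H0. nra.
Qed.

Lemma reflect_on_axis (tau x0 s x y : R) :
  y - s - tau * (x - x0) = 0 -> reflect tau x0 s (x, y) = (x, y).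
Proof.
  intros H. unfold reflect; simpl. rewrite H. f_equal; ring.
Qed.

Lemma reflect_along_line (tau x0 s x y e1 e2 t : R) :
  let k := 2 / (1 + tau ^ 2) in
  let e := y - s - tau * (x - x0) in
  let d := e2 - tau * e1 in
  reflect tau x0 s (x + e1 * t, y + e2 * t) =
    (x + k * tau * e + (e1 + k * tau * d) * t, y - k * e + (e2 - k * d) * t).
Proof.
  intros k e d. unfold reflect, e, d; simpl fst; simpl snd. fold k. f_equal; ring.
Qed.

(* The two mixed terms cancel because the reflected axes are orthonormal. *)
Lemma semilinear_reflected (f : R -> R) (S : half_plane_solution f) (tau x0 s x y : R) :
  0 < snd (reflect tau x0 s (x, y)) -> semilinear_at f (reflected S tau x0 s) x y.
Proof.
  intros Hy.
  set (k := 2 / (1 + tau ^ 2)).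
  set (ax := k * tau * (y - s + tau * x0)). set (bx := y - k * (y - s + tau * x0)).
  set (ay := x + k * tau * (- s - tau * (x - x0))). set (cy := k * (s + tau * (x - x0))).
  assert (Rx : forall t, reflect tau x0 s (t, y) =
            (ax + (1 - k * tau ^ 2) * t, bx + (k * tau) * t)).
  { intros t. unfold reflect, ax, bx; simpl fst; simpl snd. fold k. f_equal; ring. }
  assert (Ry : forall t, reflect tau x0 s (x, t) =
            (ay + (k * tau) * t, cy + (1 - k) * t)).
  { intros t. unfold reflect, ay, cy; simpl fst; simpl snd. fold k. f_equal; ring. }
  assert (A := derive2_along_line f S ax bx (1 - k * tau ^ 2) (k * tau) x).
  assert (B := derive2_along_line f S ay cy (k * tau) (1 - k) y).
  rewrite <- Rx in A. rewrite <- Ry in B.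
  specialize (A ltac:(rewrite Rx in Hy; exact Hy)).
  specialize (B ltac:(rewrite Ry in Hy; exact Hy)).
  do 4 eexists. split; [|split].
  - eapply derive2_ext; [|exact A]. intros t; simpl. rewrite <- Rx. reflexivity.
  - eapply derive2_ext; [|exact B]. intros t; simpl. rewrite <- Ry. reflexivity.
  - unfold reflected.
    destruct (reflect tau x0 s (x, y)) as [rx ry]. simpl in Hy.
    rewrite <- (sol_eq f S) by assumption.
    assert (Hk : k * (1 + tau ^ 2) = 2) by (unfold k; field; nra).
    assert (H1 : 1 - k * tau ^ 2 = - (1 - k)) by lra.
    assert (H2 : (1 - k) ^ 2 + (k * tau) ^ 2 = 1).
    { replace ((1 - k) ^ 2 + (k * tau) ^ 2) with (1 - 2 * k + k * (k * (1 + tau ^ 2))) by ring.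
      rewrite Hk. ring. }
    rewrite H1.
    match goal with |- ?l = ?r =>
      replace l with (((1 - k) ^ 2 + (k * tau) ^ 2) * r) by ring end.
    rewrite H2. ring.
Qed.

Lemma ex_derive_reflected_diff (f : R -> R) (S : half_plane_solution f)
    (tau x0 s x y e1 e2 : R) :
  0 < y -> y - s - tau * (x - x0) <= 0 ->
  ex_derive (fun t => reflected S tau x0 s (x + t * e1, y + t * e2) -
                      sol S (x + t * e1, y + t * e2)) 0.
Proof.
  intros Hy He.
  apply (ex_derive_ext (fun t => reflected S tau x0 s (x + e1 * t, y + e2 * t) -
                                 sol S (x + e1 * t, y + e2 * t))).
  { intros t. simpl. rewrite (Rmult_comm t e1), (Rmult_comm t e2). reflexivity. }
  apply (ex_derive_minus (fun t => reflected S tau x0 s (x + e1 * t, y + e2 * t))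
           (fun t => sol S (x + e1 * t, y + e2 * t))).
  - set (k := 2 / (1 + tau ^ 2)). set (e := y - s - tau * (x - x0)) in *.
    set (d := e2 - tau * e1).
    apply (ex_derive_ext (fun t => sol S
      (x + k * tau * e + (e1 + k * tau * d) * t, y - k * e + (e2 - k * d) * t))).
    { intros t. simpl. unfold reflected. rewrite reflect_along_line. reflexivity. }
    eexists. apply is_derive_along_line; [|apply du_x_cont|apply sol_dx|apply sol_dy].
    assert (0 < k) by (apply Rdiv_lt_0_compat; nra). nra.
  - eexists. apply is_derive_along_line; [lra|apply du_x_cont|apply sol_dx|apply sol_dy].
Qed.

(* The triangle below that line, above the axis, and on the side of the
   vertical line [x = x0] towards which the line descends. *)
Definition wedge (tau x0 s : R) (p : R * R) : Prop :=
  0 <= snd p /\ 0 <= - tau * (fst p - x0) /\ - tau * (fst p - x0) + snd p <= s.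

Lemma closed_wedge (tau x0 s : R) : closed (wedge tau x0 s).
Proof.
  unfold wedge. repeat apply closed_and;
    (apply closed_ge_continuous || apply closed_le_continuous); intros; cont.
Qed.

Lemma wedge_bounded (tau x0 s x y : R) :
  tau <> 0 -> wedge tau x0 s (x, y) ->
  x0 - s / Rabs tau <= x <= x0 + s / Rabs tau /\ 0 <= y <= s.
Proof.
  intros Ht [H1 [H2 H3]]. simpl in *.
  assert (Ha : 0 < Rabs tau) by (apply Rabs_pos_lt; assumption).
  assert (Hx : Rabs (x - x0) <= s / Rabs tau).
  { apply (Rmult_le_reg_r (Rabs tau)); [assumption|].
    unfold Rdiv. rewrite Rmult_assoc, Rinv_l, Rmult_1_r, <- Rabs_mult by lra.
    rewrite <- Rabs_Ropp. rewrite Rabs_pos_eq; lra. }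
  apply Rabs_le_between in Hx. lra.
Qed.

(* [phi], a sum of concave functions of the distances to the three sides, is a
   strict supersolution of [Laplace + L] within [eta] of the boundary, so the
   quotient of the difference by [phi] has no negative minimum there. *)
Lemma narrow_wedge (f : R -> R) (S : half_plane_solution f) (tau x0 smax : R) :
  locally_lipschitz_from_above f -> 0 < Rabs tau <= 1 -> 0 < smax ->
  exists eta, 0 < eta /\ forall s, 0 < s <= smax ->
    (forall y, 0 <= y <= s -> sol S (x0, y) <= reflected S tau x0 s (x0, y)) ->
    (forall x y, eta <= y -> eta <= - tau * (x - x0) ->
       - tau * (x - x0) + y <= s - eta -> sol S (x, y) <= reflected S tau x0 s (x, y)) ->
    forall p, wedge tau x0 s p -> sol S p <= reflected S tau x0 s p.
Proof.
  intros HL Htau Hsm.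
  assert (Ht0 : tau <> 0).
  { intros ->. rewrite Rabs_R0 in Htau; lra. }
  assert (Ht2 : 0 < tau ^ 2 <= 1).
  { rewrite <- (pow2_abs tau). nra. }
  destruct (compact_min (wedge tau x0 smax) (fun p => - sol S p)
     (x0 - smax / Rabs tau) (x0 + smax / Rabs tau) 0 smax) as [b0 [_ Hb0]].
  { apply closed_wedge. }
  { intros x y H. apply wedge_bounded; assumption. }
  { intros p _. cont. apply sol_cont. }
  { exists (x0, 0). unfold wedge; simpl. lra. }
  destruct (HL (Rmax 0 (sol S b0) + 1)) as [L [HLp HLf]].
  { pose proof (Rmax_l 0 (sol S b0)); lra. }
  assert (Hbd : forall p, wedge tau x0 smax p -> sol S p <= Rmax 0 (sol S b0) + 1).
  { intros p Hp. specialize (Hb0 p Hp). pose proof (Rmax_r 0 (sol S b0)). lra. }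
  (* Ensures [6 * L < M ^ 2 * tau ^ 2 * exp (- 1)]. Here 6 is the upper bound of [phi], [tau ^ 2]
     the smallest of the factors [1], [tau ^ 2], [1 + tau ^ 2] of the three exponentials in the
     laplacian, and [exp (- 1)] a lower bound for an exponential at distance below [eta = / M] from
     its side. So [eta] depends on [tau] and [smax] but not on [s]. *)
  set (M := 1 + 6 * L * exp 1 / tau ^ 2).
  assert (HM1 : 1 < M).
  { unfold M. assert (0 < 6 * L * exp 1 / tau ^ 2); [|lra].
    apply Rdiv_lt_0_compat; [|lra]. pose proof (exp_pos 1). nra. }
  assert (HMt : 6 * L < M ^ 2 * tau ^ 2 * exp (- 1)).
  { assert (He : exp 1 * exp (- 1) = 1) by (rewrite <- exp_plus, Rplus_opp_r; apply exp_0).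
    assert (H1 : 6 * L < M * tau ^ 2 * exp (- 1)).
    { replace (M * tau ^ 2 * exp (- 1))
        with (tau ^ 2 * exp (- 1) + 6 * L * (exp 1 * exp (- 1))) by (unfold M; field; lra).
      rewrite He. pose proof (exp_pos (- 1)). nra. }
    assert (0 < tau ^ 2 * exp (- 1)) by (apply Rmult_lt_0_compat; [lra|apply exp_pos]).
    nra. }
  exists (/ M). split; [apply Rinv_0_lt_compat; lra|].
  intros s Hs Hside Hcore p0 Hp0.
  set (phi := fun p : R * R => (2 - exp (- M * snd p)) +
     (2 - exp (- M * (- tau * (fst p - x0)))) +
     (2 - exp (- M * (s - snd p - - tau * (fst p - x0))))).
  assert (Hexp : forall d, 0 <= d -> 0 < exp (- M * d) <= 1).
  { intros d Hd. split; [apply exp_pos|]. rewrite <- exp_0.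
    assert (Hle : - M * d <= 0) by nra.
    destruct Hle as [Hlt| ->]; [left; apply exp_increasing; assumption|lra]. }
  assert (Hphib : forall p, wedge tau x0 s p -> 3 <= phi p <= 6).
  { intros [x y] [H1 [H2 H3]]. unfold phi; simpl in *.
    pose proof (Hexp y H1). pose proof (Hexp _ H2).
    pose proof (Hexp (s - y - - tau * (x - x0)) ltac:(lra)). lra. }
  assert (Hphic : forall p, continuous phi p).
  { intros p. unfold phi.
    assert (Ce : forall h : R * R -> R, (forall p, continuous h p) ->
      continuous (fun p => 2 - exp (h p)) p).
    { intros h Hh. apply (continuous_Rminus (fun _ => 2)); [apply continuous_const|].
      apply (continuous_comp h exp); [apply Hh|apply continuous_exp]. }
    apply (continuous_Rplus (fun p => 2 - exp (- M * snd p) +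
       (2 - exp (- M * (- tau * (fst p - x0)))))).
    - apply (continuous_Rplus (fun p => 2 - exp (- M * snd p))).
      + apply Ce. intros; cont.
      + apply (Ce (fun p => - M * (- tau * (fst p - x0)))). intros; cont.
    - apply (Ce (fun p => - M * (s - snd p - - tau * (fst p - x0)))). intros; cont. }
  set (w := fun p => reflected S tau x0 s p - sol S p).
  assert (Hwc : forall p, continuous w p).
  { intros p. unfold w. apply (continuous_Rminus (reflected S tau x0 s) (sol S)).
    - apply continuous_reflected.
    - apply sol_cont. }
  destruct (compact_min (wedge tau x0 s) (fun p => w p * / phi p)
     (x0 - s / Rabs tau) (x0 + s / Rabs tau) 0 s) as [[x y] [Hp Hmin]].
  { apply closed_wedge. }
  { intros x y H. apply wedge_bounded; assumption. }
  { intros p Hp. specialize (Hphib p Hp). apply (continuous_Rmult w); [apply Hwc|].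
    apply (continuous_comp phi Rinv); [apply Hphic|apply continuous_Rinv; lra]. }
  { exists p0; assumption. }
  assert (Hwn : 0 <= w (x, y)).
  { apply Rnot_lt_le; intros Hneg.
    assert (Hphi := Hphib _ Hp).
    set (mu := - (w (x, y) * / phi (x, y))).
    assert (Hmu : 0 < mu).
    { unfold mu. assert (0 < / phi (x, y)) by (apply Rinv_0_lt_compat; lra). nra. }
    assert (Hwmu : w (x, y) = - (mu * phi (x, y))) by (unfold mu; field; lra).
    (* Equality holds at [(x, y)], so [w + mu * phi] has a minimum there. The next assertions
       exclude the three sides, then the core. *)
    assert (Hz : forall p, wedge tau x0 s p -> 0 <= w p + mu * phi p).
    { intros p Hpt. specialize (Hmin p Hpt). specialize (Hphib p Hpt).
      apply (Rmult_le_compat_r (phi p)) in Hmin; [|lra].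
      rewrite (Rmult_assoc (w p)), Rinv_l, Rmult_1_r in Hmin by lra.
      unfold mu. nra. }
    destruct Hp as [Hp1 [Hp2 Hp3]]. simpl in Hp1, Hp2, Hp3.
    assert (He : y - s - tau * (x - x0) <= 0) by lra.
    assert (Hh := reflect_height _ _ _ _ _ He).
    assert (Hy : 0 < y).
    { destruct (Req_dec y 0) as [->|]; [exfalso|lra].
      unfold w in Hneg. rewrite sol_bottom in Hneg.
      assert (0 <= reflected S tau x0 s (x, 0)); [|lra].
      unfold reflected. destruct (reflect tau x0 s (x, 0)). apply sol_nonneg. assumption. }
    assert (HX : 0 < - tau * (x - x0)).
    { destruct Hp2 as [|Hp2]; [assumption|exfalso].
      assert (x = x0).
      { symmetry in Hp2. apply Rmult_integral in Hp2. destruct Hp2; lra. }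
      subst x. unfold w in Hneg. assert (Hsd := Hside y). lra. }
    assert (HD : - tau * (x - x0) + y < s).
    { destruct Hp3 as [|Hp3]; [assumption|exfalso].
      unfold w, reflected in Hneg. rewrite reflect_on_axis in Hneg; lra. }
    assert (Hnc : y < / M \/ - tau * (x - x0) < / M \/ s - y - - tau * (x - x0) < / M).
    { destruct (Rlt_le_dec y (/ M)); [tauto|].
      destruct (Rlt_le_dec (- tau * (x - x0)) (/ M)); [tauto|].
      destruct (Rlt_le_dec (s - y - - tau * (x - x0)) (/ M)); [tauto|exfalso].
      assert (Hc := Hcore x y). unfold w in Hneg. lra. }
    destruct (semilinear_sol f S x y Hy) as [a1 [a2 [a3 [a4 [A1 [A2 A3]]]]]].
    destruct (semilinear_reflected f S tau x0 s x y ltac:(lra))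
      as [b1 [b2 [b3 [b4 [B1 [B2 B3]]]]]].
    set (ey := exp (- M * y)). set (eX := exp (- M * (- tau * (x - x0)))).
    set (eD := exp (- M * (s - y - - tau * (x - x0)))).
    assert (Px : derive2 (fun t => phi (t, y)) x (- M * tau * eX + M * tau * eD)
       (- (M ^ 2 * tau ^ 2) * (eX + eD))).
    { exists (fun t => - M * tau * exp (- M * (- tau * (t - x0))) +
                  M * tau * exp (- M * (s - y - - tau * (t - x0)))).
      split; [|split].
      - apply filter_forall. intros t. unfold phi; simpl fst; simpl snd.
        auto_derive; [trivial|unfold Rminus; ring].
      - reflexivity.
      - unfold eX, eD. auto_derive; [trivial|unfold Rminus; ring]. }
    assert (Py : derive2 (fun t => phi (x, t)) y (M * ey - M * eD)
       (- M ^ 2 * (ey + eD))).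
    { exists (fun t => M * exp (- M * t) - M * exp (- M * (s - t - - tau * (x - x0)))).
      split; [|split].
      - apply filter_forall. intros t. unfold phi; simpl fst; simpl snd.
        auto_derive; [trivial|unfold Rminus; ring].
      - reflexivity.
      - unfold ey, eD. auto_derive; [trivial|unfold Rminus; ring]. }
    assert (Fx := derive2_plus _ _ _ _ _ _ _ (derive2_minus _ _ _ _ _ _ _ B1 A1)
                    (derive2_scal _ _ mu _ _ Px)).
    assert (Fy := derive2_plus _ _ _ _ _ _ _ (derive2_minus _ _ _ _ _ _ _ B2 A2)
                    (derive2_scal _ _ mu _ _ Py)).
    apply derive2_local_min in Fx.
    2:{ assert (Hl : locally x (fun t => 0 < - tau * (t - x0) /\ - tau * (t - x0) + y < s)).
        { apply filter_and.
          - apply (locally_gt (fun t => - tau * (t - x0))); [cont|assumption].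
          - apply (locally_lt (fun t => - tau * (t - x0) + y)); [cont|assumption]. }
        generalize Hl; apply filter_imp. intros t [T1 T2].
        change (w (x, y) + mu * phi (x, y) <= w (t, y) + mu * phi (t, y)).
        assert (0 <= w (t, y) + mu * phi (t, y)); [|lra].
        apply Hz. unfold wedge; simpl; lra. }
    apply derive2_local_min in Fy.
    2:{ assert (Hl : locally y (fun t => 0 < t /\ - tau * (x - x0) + t < s)).
        { apply filter_and.
          - apply (locally_gt (fun t => t)); [cont|assumption].
          - apply (locally_lt (fun t => - tau * (x - x0) + t)); [cont|assumption]. }
        generalize Hl; apply filter_imp. intros t [T1 T2].
        change (w (x, y) + mu * phi (x, y) <= w (x, t) + mu * phi (x, t)).
        assert (0 <= w (x, t) + mu * phi (x, t)); [|lra].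
        apply Hz. unfold wedge; simpl; lra. }
    destruct Fx as [_ Fx]. destruct Fy as [_ Fy].
    assert (Hlip : f (sol S (x, y)) - f (reflected S tau x0 s (x, y)) <=
       L * (sol S (x, y) - reflected S tau x0 s (x, y))).
    { apply HLf.
      - unfold reflected. destruct (reflect tau x0 s (x, y)) as [rx ry].
        apply sol_nonneg. simpl in Hh; lra.
      - unfold w in Hneg; lra.
      - apply Hbd. unfold wedge; simpl; lra. }
    assert (HLw : L * (sol S (x, y) - reflected S tau x0 s (x, y)) <= mu * (6 * L)).
    { replace (sol S (x, y) - reflected S tau x0 s (x, y)) with (mu * phi (x, y))
        by (unfold w in Hwmu; lra).
      assert (mu * phi (x, y) <= mu * 6) by (apply Rmult_le_compat_l; lra). nra. }
    assert (Hpe : 0 < ey /\ 0 < eX /\ 0 < eD).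
    { unfold ey, eX, eD. repeat split; apply exp_pos. }
    assert (Hinc : forall d, d < / M -> exp (- 1) <= exp (- M * d)).
    { intros d Hd. left. apply exp_increasing.
      apply (Rmult_lt_compat_l M) in Hd; [|lra]. rewrite Rinv_r in Hd by lra. lra. }
    assert (He1 : tau ^ 2 * exp (- 1) <= ey + tau ^ 2 * eX + (1 + tau ^ 2) * eD).
    { assert (0 <= tau ^ 2 * eX) by (apply Rmult_le_pos; lra).
      assert (0 <= tau ^ 2 * eD) by (apply Rmult_le_pos; lra).
      pose proof (exp_pos (- 1)).
      assert (tau ^ 2 * exp (- 1) <= 1 * exp (- 1)) by (apply Rmult_le_compat_r; lra).
      destruct Hnc as [Hc|[Hc|Hc]]; assert (Hi := Hinc _ Hc).
      - fold ey in Hi. lra.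
      - fold eX in Hi.
        assert (tau ^ 2 * exp (- 1) <= tau ^ 2 * eX) by (apply Rmult_le_compat_l; lra). lra.
      - fold eD in Hi. lra. }
    assert (HM2 : M ^ 2 * (tau ^ 2 * exp (- 1)) <=
       M ^ 2 * (ey + tau ^ 2 * eX + (1 + tau ^ 2) * eD)).
    { apply Rmult_le_compat_l; [nra|assumption]. }
    assert (Hsum : 0 <= mu * (6 * L) - mu * (M ^ 2 * (ey + tau ^ 2 * eX + (1 + tau ^ 2) * eD)))
      by lra.
    assert (0 < mu * (M ^ 2 * (ey + tau ^ 2 * eX + (1 + tau ^ 2) * eD) - 6 * L))
      by (apply Rmult_lt_0_compat; lra).
    lra. }
  specialize (Hmin p0 Hp0). assert (H3 := Hphib _ Hp). assert (H3' := Hphib _ Hp0).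
  assert (0 <= w (x, y) * / phi (x, y)).
  { apply Rmult_le_pos; [assumption|left; apply Rinv_0_lt_compat; lra]. }
  assert (H4 : 0 <= w p0 * / phi p0) by lra.
  apply (Rmult_le_compat_r (phi p0)) in H4; [|lra].
  rewrite Rmult_assoc, Rinv_l in H4 by lra. unfold w in H4. lra.
Qed.

(** * Continuation of the comparison in the triangles *)

Lemma continuous_triple_gt (F : R * (R * R) -> R) (z x y : R) :
  continuous F (z, (x, y)) -> 0 < F (z, (x, y)) -> exists d, 0 < d /\
    forall z' x' y', Rabs (z' - z) < d -> Rabs (x' - x) < d -> Rabs (y' - y) < d ->
      0 < F (z', (x', y')).
Proof.
  intros Hc Hp. destruct (locally_gt F (z, (x, y)) 0 Hc Hp) as [d Hd].
  exists d. split; [apply cond_pos|]. intros z' x' y' h1 h2 h3.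
  apply (Hd (z', (x', y'))). split; [exact h1|split; [exact h2|exact h3]].
Qed.

Lemma continuous_lt_near (h : R -> R) (c : R) (s : R) :
  continuous h s -> h s < c -> exists d, 0 < d /\ forall t, Rabs (t - s) < d -> h t < c.
Proof.
  intros Hc Hp. destruct (locally_lt h s c Hc Hp) as [d Hd].
  exists d. split; [apply cond_pos|]. intros t Ht. apply (Hd t). exact Ht.
Qed.

Lemma continuous_reflected_param {T : UniformSpace} (f : R -> R) (S : half_plane_solution f)
    (x0 : R) (tau s x y : T -> R) (t : T) :
  continuous tau t -> continuous s t -> continuous x t -> continuous y t ->
  continuous (fun t => reflected S (tau t) x0 (s t) (x t, y t)) t.
Proof.
  intros Ht Hs Hx Hy. unfold reflected, reflect; simpl fst; simpl snd.
  assert (Hk : continuous (fun t => 2 / (1 + tau t ^ 2)) t).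
  { apply (continuous_Rmult (fun _ => 2)); [apply continuous_const|].
    apply (continuous_comp (fun t => 1 + tau t ^ 2) Rinv); [cont|].
    apply continuous_Rinv. nra. }
  apply (continuous_after (fun t =>
     (x t + 2 / (1 + tau t ^ 2) * tau t * (y t - s t - tau t * (x t - x0)),
      y t - 2 / (1 + tau t ^ 2) * (y t - s t - tau t * (x t - x0)))) (sol S)).
  - apply sol_cont.
  - cont.
Qed.

(** Induction on the height [s]. The inequality passes to the limit height, becomes strict inside by
    [strong_comparison], persists on a compact core for slightly larger heights, and [narrow_wedge]
    recovers the rest of the triangle. *)
Lemma wedge_comparison (f : R -> R) (S : half_plane_solution f) (tau x0 smax : R) :
  locally_lipschitz_from_above f -> (forall t, 0 < t -> one_sided_osgood f t) ->
  0 < Rabs tau <= 1 ->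
  (forall s y, 0 < s <= smax -> 0 <= y <= s ->
     sol S (x0, y) <= reflected S tau x0 s (x0, y)) ->
  forall s, 0 < s -> s <= smax ->
  forall p, wedge tau x0 s p -> sol S p <= reflected S tau x0 s p.
Proof.
  intros HL HO Htau Hside.
  destruct (Rlt_le_dec 0 smax) as [Hsm|Hsm]; [|intros; lra].
  destruct (narrow_wedge f S tau x0 smax HL Htau Hsm) as [eta [Heta Hnar]].
  apply (real_induction (fun s => s <= smax ->
    forall p, wedge tau x0 s p -> sol S p <= reflected S tau x0 s p)).
  intros s Hs0 IH.
  destruct (Rlt_le_dec smax s) as [Hc|Hss].
  { exists 1. split; [lra|]. intros s' Hs' Hle. apply IH; lra. }
  destruct Hs0 as [Hs0|<-].
  (* A triangle of height below [eta] has no core, so [narrow_wedge] applies at once. *)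
  2:{ exists eta. split; [assumption|]. intros s' Hs' Hle. apply Hnar.
      - lra.
      - intros y Hy. apply Hside; lra.
      - intros; lra. }
  assert (Hgood : forall p, wedge tau x0 s p -> sol S p <= reflected S tau x0 s p).
  { intros [x y] [H1 [H2 H3]]. simpl in *.
    destruct H3 as [H3|H3].
    2:{ unfold reflected. rewrite reflect_on_axis; lra. }
    apply Rnot_lt_le; intros Hlt.
    destruct (continuous_lt_near (fun s => reflected S tau x0 s (x, y)) (sol S (x, y)) s)
      as [d [Hd Hnear]].
    { apply (continuous_reflected_param f S x0 (fun _ => tau) (fun s => s)
        (fun _ => x) (fun _ => y)); cont. }
    { assumption. }
    set (lo := - tau * (x - x0) + y) in *.
    assert (Hlo : 0 <= lo) by (unfold lo; lra).
    (* Smaller than [s], yet large enough that [(x, y)] already lies in the triangle of height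
       [s']. *)
    set (s' := Rmax ((lo + s) / 2) (s - d / 2)).
    assert (Hs' : lo < s' < s /\ s - d < s').
    { unfold s', Rmax. destruct Rle_dec; lra. }
    assert (sol S (x, y) <= reflected S tau x0 s' (x, y)).
    { apply IH; [lra|lra|]. unfold wedge; simpl. fold lo. lra. }
    assert (reflected S tau x0 s' (x, y) < sol S (x, y)).
    { apply Hnear. apply Rabs_def1; lra. }
    lra. }
  set (Om := fun p : R * R => 0 < snd p /\ 0 < - tau * (fst p - x0) /\
     - tau * (fst p - x0) + snd p < s).
  assert (Hstrict : forall x y, Om (x, y) -> sol S (x, y) < reflected S tau x0 s (x, y)).
  { apply (strong_comparison f).
    - unfold Om. apply open_and; [|apply open_and].
      + intros p Hp. apply locally_gt; [cont|assumption].
      + intros p Hp. apply (locally_gt (fun p : R * R => - tau * (fst p - x0))); [cont|assumption].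
      + intros p Hp. apply (locally_lt (fun p : R * R => - tau * (fst p - x0) + snd p));
          [cont|assumption].
    - apply sol_cont.
    - apply continuous_reflected.
    - intros x y [H1 [H2 H3]]. simpl in *.
      assert (Hh := reflect_height tau x0 s x y ltac:(lra)).
      split; [apply semilinear_sol; assumption|].
      split; [apply semilinear_reflected; lra|].
      split; [|apply HO, sol_pos; assumption].
      split; [apply sol_nonneg; lra|]. apply Hgood. unfold wedge; simpl; lra.
    - intros x y e1 e2 [H1 [H2 H3]]. simpl in *. apply ex_derive_reflected_diff; lra.
    - intros x y [H1 [H2 H3]]. simpl in *. split; [assumption|]. split.
      + rewrite sol_bottom.
        assert (Hh := reflect_height_lt tau x0 s x 0 ltac:(lra)).
        unfold reflected. destruct (reflect tau x0 s (x, 0)). apply sol_pos; assumption.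
      + intros y' Hy'. unfold Om; simpl. lra. }
  (* The margin at the slanted side is [eta / 2] instead of [eta]: for [s' < s + eta / 2] the core
     of the triangle of height [s'] still lies in [K]. *)
  set (K := fun p : R * R => eta <= snd p /\ eta <= - tau * (fst p - x0) /\
     - tau * (fst p - x0) + snd p <= s - eta / 2).
  assert (HK : closed K).
  { unfold K. repeat apply closed_and;
      (apply closed_ge_continuous || apply closed_le_continuous); intros; cont. }
  destruct (uniform_neighborhood
     (fun z x y => K (x, y) -> sol S (x, y) < reflected S tau x0 (s + z) (x, y))
     (x0 - s / Rabs tau) (x0 + s / Rabs tau) 0 s) as [d [Hd Hun]].
  { intros x y _ _. destruct (classic (K (x, y))) as [Hk|Hk].
    - destruct (continuous_triple_gt
        (fun q => reflected S tau x0 (s + fst q) (fst (snd q), snd (snd q)) -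
                  sol S (fst (snd q), snd (snd q))) 0 x y) as [d [Hd Hc]].
      + apply (continuous_Rminus
          (fun q => reflected S tau x0 (s + fst q) (fst (snd q), snd (snd q)))).
        * apply (continuous_reflected_param f S x0 (fun _ => tau)
            (fun q : R * (R * R) => s + fst q) (fun q => fst (snd q)) (fun q => snd (snd q)));
            cont; apply continuous_after; intros; cont.
        * apply (continuous_after (fun q : R * (R * R) => (fst (snd q), snd (snd q))) (sol S)).
          -- apply sol_cont.
          -- cont; apply continuous_after; intros; cont.
      + simpl. rewrite Rplus_0_r.
        assert (sol S (x, y) < reflected S tau x0 s (x, y)); [|lra].
        apply Hstrict. destruct Hk as [K1 [K2 K3]]. unfold Om; simpl in *; lra.
      + exists d. split; [assumption|]. intros z x' y' Hz Hx Hy _.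
        specialize (Hc z x' y'). simpl in Hc. rewrite Rminus_0_r in Hc.
        specialize (Hc Hz Hx Hy). lra.
    - destruct (closed_compl_nbhs K x y HK Hk) as [d [Hd Hc]].
      exists d. split; [assumption|]. intros z x' y' _ Hx Hy Hk'.
      exfalso. exact (Hc x' y' Hx Hy Hk'). }
  exists (Rmin d (eta / 2)). split; [apply Rmin_glb_lt; lra|].
  intros s' Hs' Hle. destruct (Rlt_le_dec s' s) as [Hl|Hl]; [apply IH; lra|].
  assert (Hd1 := Rmin_l d (eta / 2)). assert (Hd2 := Rmin_r d (eta / 2)).
  apply Hnar.
  - lra.
  - intros y Hy. apply Hside; lra.
  - intros x y H1 H2 H3.
    assert (Ht : tau <> 0) by (intros ->; rewrite Rabs_R0 in Htau; lra).
    destruct (wedge_bounded tau x0 s x y Ht) as [Hb1 Hb2].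
    { unfold wedge; simpl; lra. }
    left. replace s' with (s + (s' - s)) by ring. apply Hun; try lra.
    + rewrite Rabs_pos_eq; lra.
    + unfold K; simpl; lra.
Qed.

(** * Horizontal reflections and the direction of the gradient *)

Lemma reflected_horizontal (f : R -> R) (S : half_plane_solution f) (x0 s x y : R) :
  reflected S 0 x0 s (x, y) = sol S (x, 2 * s - y).
Proof. unfold reflected, reflect; simpl. do 2 f_equal; field. Qed.

(** Slope 0 turns the reflection into [y -> 2 * s - y]. Strictness is [strong_comparison] in the
    strip; the sign of the derivative is Hopf's lemma in the disc whose diameter joins the axis to
    [(x, s)]. *)
Lemma strip_strict (f : R -> R) (S : half_plane_solution f) (s : R) :
  (forall t, 0 < t -> one_sided_osgood f t) -> 0 < s ->
  (forall x y, 0 <= y <= s -> sol S (x, y) <= sol S (x, 2 * s - y)) ->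
  (forall x y, 0 <= y < s -> sol S (x, y) < sol S (x, 2 * s - y)) /\
  (forall x, 0 < du_y S (x, s)).
Proof.
  intros HO Hs Hle.
  assert (Hint : forall x y, 0 < y < s -> sol S (x, y) < reflected S 0 0 s (x, y)).
  { intros x y Hy.
    apply (strong_comparison f (sol S) _ (fun p => 0 < snd p /\ snd p < s)); try assumption.
    - apply open_and.
      + intros p Hp. apply locally_gt; [cont|assumption].
      + intros p Hp. apply locally_lt; [cont|assumption].
    - apply sol_cont.
    - apply continuous_reflected.
    - clear x y Hy. intros x y [H1 H2]. simpl in *.
      assert (Hh := reflect_height 0 0 s x y ltac:(lra)).
      split; [apply semilinear_sol; assumption|].
      split; [apply semilinear_reflected; lra|].
      split; [|apply HO, sol_pos; assumption].
      split; [apply sol_nonneg; lra|]. rewrite reflected_horizontal. apply Hle; lra.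
    - clear x y Hy. intros x y e1 e2 [H1 H2]. simpl in *. apply ex_derive_reflected_diff; lra.
    - clear x y Hy. intros x y [H1 H2]. simpl in *. split; [assumption|]. split.
      + rewrite reflected_horizontal, sol_bottom. apply sol_pos; lra.
      + intros; lra. }
  split.
  { intros x y Hy. destruct (Req_dec y 0) as [->|Hy0].
    - rewrite sol_bottom. apply sol_pos; lra.
    - rewrite <- (reflected_horizontal f S 0). apply Hint; lra. }
  intros x.
  destruct (hopf_touching f (sol S) (reflected S 0 0 s) x (s / 2) 0 (s / 2))
    as [a [l0 [Ha [Hl0 H]]]].
  - nra.
  - apply sol_cont.
  - apply continuous_reflected.
  - apply HO, sol_pos; lra.
  - rewrite reflected_horizontal. do 2 f_equal; field.
  - intros x' y' Hq. assert (Hy : Rabs (y' - s / 2) <= s / 2).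
    { apply Rabs_le_of_sq; [lra|]. pose proof (pow2_ge_0 (x' - x)). lra. }
    apply Rabs_le_between in Hy. rewrite reflected_horizontal.
    split; [apply sol_nonneg; lra|apply Hle; lra].
  - intros x' y' Hq. assert (Hy : (y' - s / 2) ^ 2 < (s / 2) ^ 2).
    { pose proof (pow2_ge_0 (x' - x)). lra. }
    assert (Hy1 : 0 < y' < s) by (split; nra).
    assert (Hh := reflect_height 0 0 s x' y' ltac:(lra)).
    split; [apply semilinear_sol; lra|]. split; [apply semilinear_reflected; lra|].
    apply Hint; assumption.
  (* The derivative of [phi] at 0 is twice [du_y]. Moving down by [t] from the top of the disc of
     radius [s / 2] means [1 - l = 2 * t / s]. *)
  - set (phi := fun t => sol S (x + 0 * t, s + 1 * t) - sol S (x + 0 * t, s + (-1) * t)).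
    assert (D1 := is_derive_along_line (sol S) (du_x S) (du_y S) x s 0 1 0 ltac:(lra)
       (du_x_cont f S) (sol_dx f S) (sol_dy f S)).
    assert (D2 := is_derive_along_line (sol S) (du_x S) (du_y S) x s 0 (-1) 0 ltac:(lra)
       (du_x_cont f S) (sol_dx f S) (sol_dy f S)).
    assert (D := is_derive_minus _ _ _ _ _ D1 D2). fold phi in D.
    apply (derive_ge_slope phi _ (2 * a / s) ((1 - l0) * s / 2)) in D.
    + unfold minus, plus, opp in D; simpl in D.
      replace (x + 0 * 0) with x in D by ring. replace (s + 1 * 0) with s in D by ring.
      replace (s + -1 * 0) with s in D by ring.
      assert (0 < 2 * a / s) by (apply Rdiv_lt_0_compat; lra). lra.
    + nra.
    + intros t Ht. specialize (H (1 - 2 * t / s)).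
      replace (a * (1 - (1 - 2 * t / s))) with (2 * a / s * t) in H by (field; lra).
      replace (x + (1 - 2 * t / s) * 0) with x in H by ring.
      replace (s / 2 + (1 - 2 * t / s) * (s / 2)) with (s - t) in H by (field; lra).
      rewrite reflected_horizontal in H. unfold phi.
      replace (x + 0 * 0) with x by ring. replace (x + 0 * t) with x by ring.
      replace (s + 1 * 0) with s by ring. replace (s + -1 * 0) with s by ring.
      replace (s + 1 * t) with (2 * s - (s - t)) by ring.
      replace (s + -1 * t) with (s - t) by ring.
      assert (0 <= 2 * t / s <= 1 - l0); [|lra].
      split; [apply Rdiv_le_0_compat; lra|].
      apply (Rmult_le_reg_r s); [assumption|]. unfold Rdiv.
      rewrite Rmult_assoc, Rinv_l by lra. lra.
Qed.

(** The gradient stays in a cone around the vertical, so [sol] increases in all nearly vertical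
    directions. Only [0 < y] is considered, since both derivatives may vanish at the foot. *)
Definition cone_at {f : R -> R} (S : half_plane_solution f) (x0 s : R) : Prop :=
  exists rho K, 0 < rho /\ 0 <= K /\ forall x y,
    Rabs (x - x0) < rho -> Rabs (y - s) < rho -> 0 < y ->
    0 < du_y S (x, y) /\ Rabs (du_x S (x, y)) <= K * du_y S (x, y).

Lemma cone_of_positive (f : R -> R) (S : half_plane_solution f) (x0 s : R) :
  0 < du_y S (x0, s) -> cone_at S x0 s.
Proof.
  intros H. set (c := du_y S (x0, s) / 2). assert (Hc : 0 < c) by (unfold c; lra).
  destruct (continuous_pair_eps (du_y S) x0 s (du_y_cont f S _) c Hc) as [d1 [Hd1 C1]].
  destruct (continuous_pair_eps (du_x S) x0 s (du_x_cont f S _) 1 Rlt_0_1) as [d2 [Hd2 C2]].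
  set (B := Rabs (du_x S (x0, s)) + 1).
  assert (HB : 0 < B) by (unfold B; pose proof (Rabs_pos (du_x S (x0, s))); lra).
  exists (Rmin d1 d2), (B / c). split; [apply Rmin_glb_lt; assumption|].
  split; [apply Rdiv_le_0_compat; lra|]. intros x y Hx Hy _.
  assert (M1 := Rmin_l d1 d2). assert (M2 := Rmin_r d1 d2).
  specialize (C1 x y ltac:(lra) ltac:(lra)). specialize (C2 x y ltac:(lra) ltac:(lra)).
  apply Rabs_def2 in C1.
  assert (Hy2 : c <= du_y S (x, y)) by (unfold c in *; lra).
  split; [lra|].
  assert (Rabs (du_x S (x, y)) <= B).
  { unfold B. replace (du_x S (x, y)) with
      ((du_x S (x, y) - du_x S (x0, s)) + du_x S (x0, s)) by ring.
    pose proof (Rabs_triang (du_x S (x, y) - du_x S (x0, s)) (du_x S (x0, s))). lra. }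
  assert (B / c * c <= B / c * du_y S (x, y)).
  { apply Rmult_le_compat_l; [apply Rdiv_le_0_compat; lra|assumption]. }
  replace (B / c * c) with B in H1 by (field; lra). lra.
Qed.

Lemma continuity_pt_along (H : R * R -> R) (a b al be t : R) :
  (forall p, continuous H p) -> continuity_pt (fun t => H (a + al * t, b + be * t)) t.
Proof.
  intros HH. apply continuity_pt_filterlim.
  apply (continuous_after (fun t => (a + al * t, b + be * t)) H); [assumption|cont].
Qed.

(** The segment from a point to its reflection has direction [(- tau, 1)], and the derivative of
    [sol] along it is a positive multiple of [du_y - tau * du_x], nonnegative by the cone
    condition. *)
Lemma segment_near_tip (f : R -> R) (S : half_plane_solution f) (x0 s0 : R) :
  0 <= s0 -> cone_at S x0 s0 -> exists d, 0 < d /\ forall tau s y,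
    Rabs tau < d -> Rabs (s - s0) < d -> Rabs (y - s0) < d -> 0 <= y <= s ->
    sol S (x0, y) <= reflected S tau x0 s (x0, y).
Proof.
  intros Hs0 [rho [K [Hrho [HK Hcone]]]].
  (* [rho / 8] keeps the whole segment in the neighborhood of the cone condition; [/ (K + 1)] gives
     [Rabs (tau * du_x) <= du_y]. *)
  set (d := Rmin (Rmin 1 (rho / 8)) (/ (K + 1))).
  assert (Hd : 0 < d /\ d <= 1 /\ d <= rho / 8 /\ d <= / (K + 1)).
  { unfold d. assert (0 < / (K + 1)) by (apply Rinv_0_lt_compat; lra).
    pose proof (Rmin_l (Rmin 1 (rho / 8)) (/ (K + 1))).
    pose proof (Rmin_r (Rmin 1 (rho / 8)) (/ (K + 1))).
    pose proof (Rmin_l 1 (rho / 8)). pose proof (Rmin_r 1 (rho / 8)).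
    repeat split; try lra. repeat apply Rmin_glb_lt; lra. }
  exists d. split; [lra|]. intros tau s y Ht Hs Hy Hys.
  apply Rabs_def2 in Hs. apply Rabs_def2 in Hy.
  set (e := y - s). set (k := 2 / (1 + tau ^ 2)).
  assert (Hk : 0 < k <= 2).
  { unfold k. split; [apply Rdiv_lt_0_compat; nra|].
    apply (Rmult_le_reg_r (1 + tau ^ 2)); [nra|]. unfold Rdiv.
    rewrite Rmult_assoc, Rinv_l by nra. nra. }
  destruct (Req_dec e 0) as [He|He].
  { unfold reflected. rewrite reflect_on_axis; [lra|]. unfold e in He. lra. }
  assert (He0 : - (2 * d) < e < 0) by (unfold e in *; lra).
  assert (Hke : 0 < - (k * e) < 4 * d) by nra.
  assert (Hkt : Rabs (k * tau * e) < 4 * d).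
  { replace (k * tau * e) with (k * e * tau) by ring.
    rewrite Rabs_mult, <- (Rabs_Ropp (k * e)), (Rabs_pos_eq (- (k * e))) by lra.
    pose proof (Rabs_pos tau). nra. }
  destruct (MVT_open (fun t => sol S (x0 + (k * tau * e) * t, y + (- (k * e)) * t))
     (fun t => (k * tau * e) * du_x S (x0 + (k * tau * e) * t, y + (- (k * e)) * t) +
               (- (k * e)) * du_y S (x0 + (k * tau * e) * t, y + (- (k * e)) * t))
     0 1 Rlt_0_1) as [c [Hc Heq]].
  - intros t Ht'.
    apply is_derive_along_line; [nra|apply du_x_cont|apply sol_dx|apply sol_dy].
  - intros t _. apply continuity_pt_along, sol_cont.
  - replace (x0 + k * tau * e * 0) with x0 in Heq by ring.
    replace (y + - (k * e) * 0) with y in Heq by ring.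
    replace (sol S (x0 + k * tau * e * 1, y + - (k * e) * 1))
      with (reflected S tau x0 s (x0, y)) in Heq.
    2:{ unfold reflected, reflect; simpl fst; simpl snd. fold k. unfold e.
        do 2 f_equal; ring. }
    set (X := x0 + k * tau * e * c) in *. set (Y := y + - (k * e) * c) in *.
    assert (HX : Rabs (X - x0) < rho).
    { unfold X. replace (x0 + k * tau * e * c - x0) with (k * tau * e * c) by ring.
      rewrite Rabs_mult, (Rabs_pos_eq c) by lra. pose proof (Rabs_pos (k * tau * e)). nra. }
    assert (HY : Rabs (Y - s0) < rho).
    { unfold Y. assert (0 <= - (k * e) * c <= 4 * d) by nra. apply Rabs_def1; lra. }
    assert (HYp : 0 < Y) by (unfold Y in *; nra).
    destruct (Hcone X Y HX HY HYp) as [Hp Hq].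
    assert (HtK : Rabs tau * (K + 1) <= 1).
    { apply (Rle_trans _ (/ (K + 1) * (K + 1))).
      - apply Rmult_le_compat_r; lra.
      - rewrite Rinv_l; lra. }
    assert (Hm : Rabs (tau * du_x S (X, Y)) <= du_y S (X, Y)).
    { rewrite Rabs_mult. pose proof (Rabs_pos tau). nra. }
    apply Rabs_le_between in Hm.
    assert (0 <= - (k * e) * (du_y S (X, Y) - tau * du_x S (X, Y)))
      by (apply Rmult_le_pos; lra).
    lra.
Qed.

(** * The boundary and the induction on the height *)

(** Compactness in [(s, y)]: below the tip the strict inequality at slope 0 persists for small
    slopes, at the tip [segment_near_tip] applies, and above it the claim is void. *)
Lemma segment_comparison (f : R -> R) (S : half_plane_solution f) (x0 La : R) :
  0 <= La -> (forall s, 0 <= s <= La -> cone_at S x0 s) ->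
  (forall s y, 0 < s <= La -> 0 <= y < s -> sol S (x0, y) < sol S (x0, 2 * s - y)) ->
  exists d, 0 < d /\ forall tau s y, Rabs tau < d -> 0 < s < La + d -> 0 <= y <= s ->
    sol S (x0, y) <= reflected S tau x0 s (x0, y).
Proof.
  intros HLa Hcone Hstrict.
  destruct (uniform_neighborhood
    (fun tau s y => 0 <= y <= s -> sol S (x0, y) <= reflected S tau x0 s (x0, y))
    0 La 0 La) as [d [Hd H]].
  - intros s0 y0 Hs0 Hy0. destruct (Rtotal_order y0 s0) as [Hlt|[->|Hgt]].
    + destruct (continuous_triple_gt
        (fun q => reflected S (fst q) x0 (fst (snd q)) (x0, snd (snd q)) -
                  sol S (x0, snd (snd q))) 0 s0 y0) as [d [Hd Hc]].
      * apply (continuous_Rminus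
          (fun q => reflected S (fst q) x0 (fst (snd q)) (x0, snd (snd q)))).
        -- apply (continuous_reflected_param f S x0 (fun q : R * (R * R) => fst q)
             (fun q => fst (snd q)) (fun _ => x0) (fun q => snd (snd q)));
             cont; apply continuous_after; intros; cont.
        -- apply (continuous_after (fun q : R * (R * R) => (x0, snd (snd q))) (sol S)).
           ++ apply sol_cont.
           ++ cont; apply continuous_after; intros; cont.
      * simpl. rewrite reflected_horizontal.
        assert (sol S (x0, y0) < sol S (x0, 2 * s0 - y0)) by (apply Hstrict; lra). lra.
      * exists d. split; [assumption|]. intros tau s y Ht Hs Hy _.
        specialize (Hc tau s y). simpl in Hc. rewrite Rminus_0_r in Hc.
        specialize (Hc Ht Hs Hy). lra.
    + destruct (segment_near_tip f S x0 s0 (proj1 Hs0) (Hcone s0 Hs0)) as [d [Hd H]].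
      exists d. split; [assumption|]. intros; apply H; assumption.
    + exists ((y0 - s0) / 2). split; [lra|]. intros tau s y _ Hs Hy Hys.
      apply Rabs_def2 in Hs. apply Rabs_def2 in Hy. lra.
  - exists d. split; [assumption|]. intros tau s y Ht Hs Hy. apply H; lra.
Qed.

Lemma limit_ge (h : R -> R) (c d : R) :
  continuous h 0 -> 0 < d -> (forall t, 0 < t < d -> c <= h t) -> c <= h 0.
Proof.
  intros Hh Hd H. apply Rnot_lt_le; intros Hlt.
  destruct (continuous_lt_near h c 0 Hh Hlt) as [r [Hr Hn]].
  set (t := Rmin r d / 2).
  assert (Ht : 0 < t < r /\ t < d).
  { pose proof (Rmin_glb_lt r d 0 Hr Hd). pose proof (Rmin_l r d).
    pose proof (Rmin_r r d). unfold t; lra. }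
  specialize (Hn t). rewrite Rminus_0_r, Rabs_pos_eq in Hn by lra.
  specialize (H t). lra.
Qed.

Lemma continuous_vertical (H : R * R -> R) (x y : R) :
  (forall p, continuous H p) -> continuous (fun t => H (x, t)) y.
Proof. intros HH. apply (continuous_after (fun t => (x, t)) H); [assumption|cont]. Qed.

Lemma MVT_vertical (H Hy : R * R -> R) (x y : R) :
  (forall p, continuous H p) ->
  (forall x y, 0 < y -> is_derive (fun t => H (x, t)) y (Hy (x, y))) -> 0 < y ->
  exists c, 0 < c < y /\ H (x, y) - H (x, 0) = Hy (x, c) * y.
Proof.
  intros HH Hd Hp.
  destruct (MVT_open (fun t => H (x, t)) (fun t => Hy (x, t)) 0 y Hp) as [c [Hc He]].
  - intros t Ht. apply Hd; lra.
  - intros t _. apply continuity_pt_filterlim. apply continuous_vertical; assumption.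
  - exists c. split; [assumption|]. rewrite He. ring.
Qed.

(** The values of [Hx] on the axis are limits and not known to be derivatives there, so the mean
    value theorem is used at height [y > 0] before [y] tends to 0. *)
Lemma horizontal_derivative_on_axis_le (H Hx : R * R -> R) (x : R) :
  (forall p, continuous H p) -> (forall p, continuous Hx p) ->
  (forall x y, 0 < y -> is_derive (fun t => H (t, y)) x (Hx (x, y))) ->
  (forall x, H (x, 0) = 0) -> Hx (x, 0) <= 0.
Proof.
  intros HH HHx Hd H0. apply Rnot_lt_le; intros Hlt. set (a := Hx (x, 0)) in *.
  destruct (continuous_pair_eps Hx x 0 (HHx _) (a / 2) ltac:(lra)) as [d [Hdp Hc]].
  set (h := d / 2).
  assert (L : a / 2 * h <= H (x + h, 0) - H (x, 0)).
  { apply (limit_ge (fun y => H (x + h, y) - H (x, y)) _ d).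
    - apply (continuous_Rminus (fun y => H (x + h, y))); apply continuous_vertical; assumption.
    - assumption.
    - intros y Hy.
      destruct (MVT_open (fun t => H (t, y)) (fun t => Hx (t, y)) x (x + h)) as [c [Hc1 He]].
      + unfold h; lra.
      + intros t Ht. apply Hd; lra.
      + intros t _. apply continuity_pt_filterlim.
        apply (continuous_after (fun t => (t, y)) H); [assumption|cont].
      + rewrite He. replace (x + h - x) with h by ring.
        apply Rmult_le_compat_r; [unfold h; lra|].
        assert (Hn : Rabs (Hx (c, y) - Hx (x, 0)) < a / 2).
        { apply Hc; apply Rabs_def1; unfold h in *; lra. }
        apply Rabs_def2 in Hn. fold a in Hn. lra. }
  rewrite !H0 in L. assert (0 < a / 2 * h) by (apply Rmult_lt_0_compat; unfold h; lra). lra.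
Qed.

Lemma horizontal_derivative_on_axis (H Hx : R * R -> R) (x : R) :
  (forall p, continuous H p) -> (forall p, continuous Hx p) ->
  (forall x y, 0 < y -> is_derive (fun t => H (t, y)) x (Hx (x, y))) ->
  (forall x, H (x, 0) = 0) -> Hx (x, 0) = 0.
Proof.
  intros HH HHx Hd H0.
  assert (A := horizontal_derivative_on_axis_le H Hx x HH HHx Hd H0).
  assert (B := horizontal_derivative_on_axis_le (fun p => - H p) (fun p => - Hx p) x).
  assert (- Hx (x, 0) <= 0); [|lra]. apply B.
  - intros; cont; apply HH.
  - intros; cont; apply HHx.
  - intros x' y' Hy. apply (is_derive_opp (fun t => H (t, y'))). apply Hd; assumption.
  - intros; rewrite H0; ring.
Qed.

Lemma du_y_axis_nonneg (f : R -> R) (S : half_plane_solution f) (x : R) :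
  0 <= du_y S (x, 0).
Proof.
  apply Rnot_lt_le; intros Hlt.
  destruct (continuous_lt_near (fun t => du_y S (x, t)) 0 0
    (continuous_vertical _ _ _ (du_y_cont f S)) Hlt) as [d [Hd Hn]].
  destruct (MVT_vertical (sol S) (du_y S) x (d / 2) (sol_cont f S) (sol_dy f S) ltac:(lra))
    as [c [Hc He]].
  rewrite sol_bottom in He.
  assert (Hp := sol_pos f S x (d / 2) ltac:(lra)).
  assert (du_y S (x, c) < 0) by (apply Hn; apply Rabs_def1; lra). nra.
Qed.

(** The equation extends to the axis by continuity, and [du_xx] vanishes there because first [sol]
    and then [du_x] do. *)
Lemma du_yy_axis (f : R -> R) (S : half_plane_solution f) (x : R) :
  continuous_on (fun t => 0 <= t) f -> du_yy S (x, 0) = - f 0.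
Proof.
  intros Hf.
  assert (Hx0 : forall x, du_x S (x, 0) = 0).
  { intros x'. apply (horizontal_derivative_on_axis (sol S)).
    - apply sol_cont.
    - apply du_x_cont.
    - apply sol_dx.
    - apply sol_bottom. }
  assert (Hxx0 : du_xx S (x, 0) = 0).
  { apply (horizontal_derivative_on_axis (du_x S)).
    - apply du_x_cont.
    - apply du_xx_cont.
    - apply du_x_dx.
    - exact Hx0. }
  set (h := fun t => du_xx S (x, t) + du_yy S (x, t) + f (Rmax 0 (sol S (x, t)))).
  assert (Hh : continuous h 0).
  { apply (continuous_Rplus (fun t => du_xx S (x, t) + du_yy S (x, t))).
    - apply (continuous_Rplus (fun t => du_xx S (x, t))); apply continuous_vertical.
      + apply du_xx_cont.
      + apply du_yy_cont.
    - apply (continuous_on_comp (fun t => 0 <= t) f (fun t => Rmax 0 (sol S (x, t)))).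
      + exact Hf.
      + intros y; apply Rmax_l.
      + apply (continuous_after (fun t => sol S (x, t)) (Rmax 0)).
        * intros; apply continuous_Rmax_l.
        * apply continuous_vertical, sol_cont. }
  assert (Hz : forall t, 0 < t -> h t = 0).
  { intros t Ht. unfold h. rewrite Rmax_right by (left; apply sol_pos; assumption).
    rewrite <- (sol_eq f S) by assumption. ring. }
  assert (A : 0 <= h 0).
  { apply (limit_ge h 0 1 Hh Rlt_0_1). intros t Ht. rewrite Hz; lra. }
  assert (B : 0 <= - h 0).
  { apply (limit_ge (fun t => - h t) 0 1); [cont|lra|]. intros t Ht. rewrite Hz; lra. }
  unfold h in A, B. rewrite sol_bottom, Rmax_left, Hxx0 in A, B by lra. lra.
Qed.

(** Both derivatives are compared with [y]: [du_y] starts nonnegative and grows at rate at least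
    [c], while [du_x] starts at 0 and grows at rate at most [B]. *)
Lemma cone_of_positive_second_derivative (f : R -> R) (S : half_plane_solution f) (x0 : R) :
  0 < du_yy S (x0, 0) -> cone_at S x0 0.
Proof.
  intros H. set (c := du_yy S (x0, 0) / 2). assert (Hc : 0 < c) by (unfold c; lra).
  destruct (continuous_pair_eps (du_yy S) x0 0 (du_yy_cont f S _) c Hc) as [d1 [Hd1 C1]].
  destruct (continuous_pair_eps (du_xy S) x0 0 (du_xy_cont f S _) 1 Rlt_0_1) as [d2 [Hd2 C2]].
  set (B := Rabs (du_xy S (x0, 0)) + 1).
  assert (HB : 0 < B) by (unfold B; pose proof (Rabs_pos (du_xy S (x0, 0))); lra).
  exists (Rmin d1 d2), (B / c). split; [apply Rmin_glb_lt; assumption|].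
  split; [apply Rdiv_le_0_compat; lra|]. intros x y Hx Hy Hyp.
  assert (M1 := Rmin_l d1 d2). assert (M2 := Rmin_r d1 d2).
  rewrite Rminus_0_r, Rabs_pos_eq in Hy by lra.
  assert (Hlow : c * y <= du_y S (x, y)).
  { destruct (MVT_vertical (du_y S) (du_yy S) x y (du_y_cont f S) (du_y_dy f S) Hyp)
      as [z [Hz He]].
    assert (Hn : Rabs (du_yy S (x, z) - du_yy S (x0, 0)) < c).
    { apply C1; [lra|]. apply Rabs_def1; lra. }
    apply Rabs_def2 in Hn. assert (c <= du_yy S (x, z)) by (unfold c in *; lra).
    assert (c * y <= du_yy S (x, z) * y) by (apply Rmult_le_compat_r; lra).
    pose proof (du_y_axis_nonneg f S x). lra. }
  assert (Hup : Rabs (du_x S (x, y)) <= B * y).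
  { destruct (MVT_vertical (du_x S) (du_xy S) x y (du_x_cont f S) (du_x_dy f S) Hyp)
      as [z [Hz He]].
    assert (Hx0 : du_x S (x, 0) = 0).
    { apply (horizontal_derivative_on_axis (sol S)).
      - apply sol_cont.
      - apply du_x_cont.
      - apply sol_dx.
      - apply sol_bottom. }
    rewrite Hx0, Rminus_0_r in He. rewrite He, Rabs_mult, (Rabs_pos_eq y) by lra.
    apply Rmult_le_compat_r; [lra|].
    assert (Hn : Rabs (du_xy S (x, z) - du_xy S (x0, 0)) < 1).
    { apply C2; [lra|]. apply Rabs_def1; lra. }
    unfold B. replace (du_xy S (x, z)) with
      ((du_xy S (x, z) - du_xy S (x0, 0)) + du_xy S (x0, 0)) by ring.
    pose proof (Rabs_triang (du_xy S (x, z) - du_xy S (x0, 0)) (du_xy S (x0, 0))). lra. }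
  assert (0 < c * y) by (apply Rmult_lt_0_compat; assumption).
  split; [lra|].
  assert (B / c * (c * y) <= B / c * du_y S (x, y)).
  { apply Rmult_le_compat_l; [apply Rdiv_le_0_compat; lra|assumption]. }
  replace (B / c * (c * y)) with (B * y) in H1 by (field; lra). lra.
Qed.

(** When [f 0 = 0] the zero function solves the equation, and Hopf's lemma compares [sol] with it in
    the unit disc tangent to the axis. *)
Lemma du_y_axis_pos (f : R -> R) (S : half_plane_solution f) (x : R) :
  f 0 = 0 -> one_sided_osgood f 0 -> 0 < du_y S (x, 0).
Proof.
  intros Hf0 HO.
  destruct (hopf_touching f (fun _ => 0) (sol S) x 1 0 (-1)) as [a [l0 [Ha [Hl0 H]]]].
  - lra.
  - intros; cont.
  - apply sol_cont.
  - assumption.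
  - replace (1 + -1) with 0 by ring. rewrite sol_bottom. reflexivity.
  - intros x' y' Hq. split; [lra|]. apply sol_nonneg.
    assert (Hy : Rabs (y' - 1) <= 1).
    { apply Rabs_le_of_sq; [lra|]. pose proof (pow2_ge_0 (x' - x)). lra. }
    apply Rabs_le_between in Hy. lra.
  - intros x' y' Hq. assert (Hy : 0 < y').
    { pose proof (pow2_ge_0 (x' - x)). simpl in *. nra. }
    split; [|split; [apply semilinear_sol; assumption|apply sol_pos; assumption]].
    assert (D0 : forall z, derive2 (fun _ => 0) z 0 0).
    { intros z. exists (fun _ => 0). split; [|split; [reflexivity|]].
      - apply filter_forall. intros t. apply (is_derive_const 0).
      - apply (is_derive_const 0). }
    exists 0, 0, 0, 0. split; [apply D0|split; [apply D0|]]. rewrite Hf0; ring.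
  - assert (a <= du_y S (x, 0)); [|lra]. apply Rnot_lt_le; intros Hlt.
    destruct (continuous_lt_near (fun t => du_y S (x, t)) a 0
      (continuous_vertical _ _ _ (du_y_cont f S)) Hlt) as [d [Hd Hn]].
    set (t := Rmin d (1 - l0) / 2).
    assert (Ht : 0 < t < d /\ t <= 1 - l0).
    { pose proof (Rmin_glb_lt d (1 - l0) 0 Hd ltac:(lra)). pose proof (Rmin_l d (1 - l0)).
      pose proof (Rmin_r d (1 - l0)). unfold t; lra. }
    destruct (MVT_vertical (sol S) (du_y S) x t (sol_cont f S) (sol_dy f S) ltac:(lra))
      as [c [Hc He]].
    rewrite sol_bottom in He.
    assert (Hdc : du_y S (x, c) < a) by (apply Hn; apply Rabs_def1; lra).
    specialize (H (1 - t) ltac:(lra)).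
    replace (x + (1 - t) * 0) with x in H by ring.
    replace (1 + (1 - t) * -1) with t in H by ring. nra.
Qed.

Lemma cone_at_bottom (f : R -> R) (S : half_plane_solution f) (x0 : R) :
  continuous_on (fun t => 0 <= t) f ->
  f 0 <> 0 \/ (f 0 = 0 /\ one_sided_osgood f 0) -> cone_at S x0 0.
Proof.
  intros Hf [Hf0|[Hf0 HO]].
  2:{ apply cone_of_positive, du_y_axis_pos; assumption. }
  destruct (du_y_axis_nonneg f S x0) as [Hp|Hz]; [apply cone_of_positive; assumption|].
  apply cone_of_positive_second_derivative.
  destruct (Rlt_le_dec 0 (du_yy S (x0, 0))) as [|Hle]; [assumption|exfalso].
  assert (Hlt : du_yy S (x0, 0) < 0).
  { destruct (Rlt_le_dec (du_yy S (x0, 0)) 0); [assumption|exfalso].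
    apply Hf0. rewrite du_yy_axis in * by assumption. lra. }
  (* With [du_y = 0] at the foot, a negative [du_yy] would make [du_y], and then [sol], negative
     just above it. *)
  destruct (continuous_lt_near (fun t => du_yy S (x0, t)) 0 0
    (continuous_vertical _ _ _ (du_yy_cont f S)) Hlt) as [d [Hd Hn]].
  destruct (MVT_vertical (sol S) (du_y S) x0 (d / 2) (sol_cont f S) (sol_dy f S) ltac:(lra))
    as [c [Hc He]].
  destruct (MVT_vertical (du_y S) (du_yy S) x0 c (du_y_cont f S) (du_y_dy f S) ltac:(lra))
    as [c' [Hc' He']].
  rewrite sol_bottom in He. rewrite <- Hz in He'.
  assert (du_yy S (x0, c') < 0) by (apply Hn; apply Rabs_def1; lra).
  assert (Hp := sol_pos f S x0 (d / 2) ltac:(lra)).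
  assert (du_yy S (x0, c') * c < 0) by (apply Rmult_neg_pos; lra).
  assert (du_y S (x0, c) * (d / 2) < 0) by (apply Rmult_neg_pos; lra).
  lra.
Qed.

(** At each stage [strip_strict] supplies the cones at positive heights and the strict inequalities
    on [x = 0]. [segment_comparison] gains a little height there for small slopes, and the triangles
    carry the gain to every [x], with no loss depending on [x]. *)
Lemma reflected_above (f : R -> R) (S : half_plane_solution f) :
  locally_lipschitz_from_above f -> (forall t, 0 < t -> one_sided_osgood f t) ->
  cone_at S 0 0 ->
  forall s, 0 < s -> forall x y, 0 <= y <= s -> sol S (x, y) <= sol S (x, 2 * s - y).
Proof.
  intros HL HO Hbot.
  apply (real_induction
    (fun s => forall x y, 0 <= y <= s -> sol S (x, y) <= sol S (x, 2 * s - y))).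
  intros La HLa IH.
  assert (Hcl : forall s, 0 < s <= La ->
    forall x y, 0 <= y <= s -> sol S (x, y) <= sol S (x, 2 * s - y)).
  { intros s Hs. destruct (Req_dec s La) as [->|]; [|apply IH; lra].
    intros x y Hy. destruct (Req_dec y La) as [->|].
    { right; do 2 f_equal; ring. }
    apply Rnot_lt_le; intros Hlt.
    destruct (continuous_lt_near (fun s => sol S (x, 2 * s - y)) (sol S (x, y)) La)
      as [d [Hd Hn]].
    { apply (continuous_after (fun s => (x, 2 * s - y)) (sol S)); [apply sol_cont|cont]. }
    { assumption. }
    set (s' := Rmax ((y + La) / 2) (La - d / 2)).
    assert (Hs' : y < s' < La /\ La - d < s') by (unfold s', Rmax; destruct Rle_dec; lra).
    assert (sol S (x, y) <= sol S (x, 2 * s' - y)) by (apply IH; lra).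
    assert (sol S (x, 2 * s' - y) < sol S (x, y)) by (apply Hn, Rabs_def1; lra).
    lra. }
  destruct (segment_comparison f S 0 La HLa) as [d [Hd Hseg]].
  { intros s [[Hs1|<-] Hs2]; [|assumption]. apply cone_of_positive.
    apply (strip_strict f S s HO Hs1). apply Hcl; lra. }
  { intros s y Hs Hy. apply (strip_strict f S s HO (proj1 Hs)); [apply Hcl; lra|lra]. }
  exists d. split; [assumption|]. intros s Hs x y Hy.
  destruct (Req_dec y s) as [->|].
  { right; do 2 f_equal; ring. }
  apply Rnot_lt_le; intros Hlt.
  (* The sign of the slope that puts the triangle on the side of [x]. *)
  set (sg := if Rle_dec x 0 then 1 else -1).
  assert (Hsg : Rabs sg = 1 /\ - sg * x = Rabs x).
  { unfold sg. destruct Rle_dec.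
    - rewrite Rabs_R1, (Rabs_left1 x) by assumption. lra.
    - rewrite Rabs_left, (Rabs_pos_eq x) by lra. lra. }
  destruct (continuous_lt_near (fun t => reflected S (sg * t) 0 s (x, y))
    (sol S (x, y)) 0) as [r [Hr Hn]].
  { apply (continuous_reflected_param f S 0 (fun t => sg * t) (fun _ => s)
      (fun _ => x) (fun _ => y)); cont. }
  { rewrite Rmult_0_r, reflected_horizontal. assumption. }
  assert (HX0 := Rabs_pos x).
  (* The last bound gives [t * Rabs x < s - y], so that the triangle reaches [(x, y)]; [r] keeps the
     assumed failure at slope 0 visible at slope [sg * t]. *)
  set (t := Rmin (Rmin r d) (Rmin 1 ((s - y) / (1 + Rabs x))) / 2).
  assert (Hq : 0 < (s - y) / (1 + Rabs x)) by (apply Rdiv_lt_0_compat; lra).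
  assert (Ht : 0 < t /\ t < r /\ t < d /\ t < 1 /\ t < (s - y) / (1 + Rabs x)).
  { assert (0 < Rmin (Rmin r d) (Rmin 1 ((s - y) / (1 + Rabs x)))).
    { repeat apply Rmin_glb_lt; lra. }
    pose proof (Rmin_l (Rmin r d) (Rmin 1 ((s - y) / (1 + Rabs x)))).
    pose proof (Rmin_r (Rmin r d) (Rmin 1 ((s - y) / (1 + Rabs x)))).
    pose proof (Rmin_l r d). pose proof (Rmin_r r d).
    pose proof (Rmin_l 1 ((s - y) / (1 + Rabs x))).
    pose proof (Rmin_r 1 ((s - y) / (1 + Rabs x))).
    fold t in H0. unfold t. lra. }
  destruct Ht as [Ht0 [Ht1 [Ht2 [Ht3 Ht4]]]].
  apply (Rmult_lt_compat_r (1 + Rabs x)) in Ht4; [|lra].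
  replace ((s - y) / (1 + Rabs x) * (1 + Rabs x)) with (s - y) in Ht4 by (field; lra).
  assert (Habs : Rabs (sg * t) = t).
  { rewrite Rabs_mult, (proj1 Hsg), (Rabs_pos_eq t) by lra. ring. }
  assert (HX : - (sg * t) * (x - 0) = t * Rabs x) by (rewrite <- (proj2 Hsg); ring).
  assert (sol S (x, y) <= reflected S (sg * t) 0 s (x, y)).
  { apply (wedge_comparison f S (sg * t) 0 s HL HO).
    - rewrite Habs. lra.
    - intros s' y' Hs' Hy'. apply Hseg; [rewrite Habs; lra|lra|lra].
    - lra.
    - lra.
    - unfold wedge; simpl fst; simpl snd. rewrite HX.
      split; [lra|]. split; [apply Rmult_le_pos; lra|lra]. }
  assert (reflected S (sg * t) 0 s (x, y) < sol S (x, y)).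
  { apply Hn. rewrite Rminus_0_r, Rabs_pos_eq; lra. }
  lra.
Qed.

Lemma du_y_pos (f : R -> R) (S : half_plane_solution f) :
  continuous_on (fun t => 0 <= t) f -> locally_lipschitz_from_above f ->
  (forall t, 0 < t -> one_sided_osgood f t) ->
  f 0 <> 0 \/ (f 0 = 0 /\ one_sided_osgood f 0) ->
  forall x y, 0 < y -> 0 < du_y S (x, y).
Proof.
  intros Hf HL HO H0 x y Hy.
  apply (strip_strict f S y HO Hy).
  apply reflected_above; try assumption. apply cone_at_bottom; assumption.
Qed.

(** * Extension below the axis and conclusion *)

Lemma continuous_extension (w : R * R -> R) :
  continuous_on closed_half_plane w ->
  forall p, continuous (fun p => w (fst p, Rmax 0 (snd p))) p.
Proof.
  intros Hw p.
  apply (continuous_on_comp closed_half_plane w (fun p => (fst p, Rmax 0 (snd p)))).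
  - exact Hw.
  - intros q. apply Rmax_l.
  - apply continuous_to_pair; [cont|]. apply (continuous_after snd (Rmax 0)).
    + intros; apply continuous_Rmax_l.
    + cont.
Qed.

Lemma derive_extension (w wx wy : R * R -> R) :
  (forall x y, open_half_plane (x, y) ->
     is_derive (fun t => w (t, y)) x (wx (x, y)) /\
     is_derive (fun t => w (x, t)) y (wy (x, y))) ->
  forall x y, 0 < y ->
    is_derive (fun t => w (t, Rmax 0 y)) x (wx (x, Rmax 0 y)) /\
    is_derive (fun t => w (x, Rmax 0 t)) y (wy (x, Rmax 0 y)).
Proof.
  intros H x y Hy. destruct (H x y Hy) as [A B].
  rewrite !(Rmax_right 0 y) by lra. split; [assumption|].
  apply (is_derive_ext_loc (fun t => w (x, t))); [|assumption].
  assert (L : locally y (fun t => 0 < t)) by (apply (locally_gt (fun t => t)); [cont|assumption]).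
  generalize L; apply filter_imp. intros t Ht. rewrite Rmax_right by lra. reflexivity.
Qed.

Lemma solution_extension (f : R -> R) (u : R * R -> R) :
  C_closed_half_plane 2 u -> solution f u ->
  exists S : half_plane_solution f,
    forall x y, 0 < y -> Derive (fun t => u (x, t)) y = du_y S (x, y).
Proof.
  intros [Hu [ux [uy [[Hux [uxx [uxy [[Huxx _] [[Huxy _] Dux]]]]]
    [[Huy [uyx [uyy [[Huyx _] [[Huyy _] Duy]]]]] Du]]]]] [Heq [Hpos Hbot]].
  set (E := fun (w : R * R -> R) (p : R * R) => w (fst p, Rmax 0 (snd p))).
  assert (HE : forall w x y, 0 < y -> E w (x, y) = w (x, y)).
  { intros w x y Hy. unfold E; simpl. rewrite Rmax_right by lra. reflexivity. }
  assert (Dxx : forall x y, 0 < y -> Derive_n (fun t => u (t, y)) 2 x = uxx (x, y)).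
  { intros x y Hy. simpl. rewrite (Derive_ext _ (fun t => ux (t, y))).
    - apply is_derive_unique, Dux. exact Hy.
    - intros t. apply is_derive_unique, Du. exact Hy. }
  assert (Dyy : forall x y, 0 < y -> Derive_n (fun t => u (x, t)) 2 y = uyy (x, y)).
  { intros x y Hy. simpl. rewrite (Derive_ext_loc _ (fun t => uy (x, t))).
    - apply is_derive_unique, Duy. exact Hy.
    - assert (L : locally y (fun t => 0 < t))
        by (apply (locally_gt (fun t => t)); [cont|assumption]).
      generalize L; apply filter_imp. intros t Ht. apply is_derive_unique, Du. exact Ht. }
  unshelve eexists (Build_half_plane_solution f (E u) (E ux) (E uy) (E uxx) (E uxy) (E uyx) (E uyy)
    (continuous_extension u Hu) (continuous_extension ux Hux) (continuous_extension uy Huy)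
    (continuous_extension uxx Huxx) (continuous_extension uxy Huxy)
    (continuous_extension uyx Huyx) (continuous_extension uyy Huyy)
    (fun x y Hy => proj1 (derive_extension u ux uy Du x y Hy))
    (fun x y Hy => proj2 (derive_extension u ux uy Du x y Hy))
    (fun x y Hy => proj1 (derive_extension ux uxx uxy Dux x y Hy))
    (fun x y Hy => proj2 (derive_extension ux uxx uxy Dux x y Hy))
    (fun x y Hy => proj1 (derive_extension uy uyx uyy Duy x y Hy))
    (fun x y Hy => proj2 (derive_extension uy uyx uyy Duy x y Hy)) _ _ _).
  - intros x y Hy. rewrite !HE by assumption. rewrite <- Heq by exact Hy.
    unfold laplacian. rewrite Dxx, Dyy by assumption. reflexivity.
  - intros x y Hy. rewrite HE by assumption. apply Hpos; exact Hy.
  - intros x. unfold E; simpl. rewrite Rmax_left by lra. apply Hbot.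
  - intros x y Hy. simpl. rewrite HE by assumption. apply is_derive_unique, Du. exact Hy.
Qed.

Theorem theorem1p2 (f : R -> R) (u : R * R -> R)
  (hu : C_closed_half_plane 2 u)
  (hsol : solution f u)
  (hfc : continuous_on (fun t => 0 <= t) f)
  (hfL : locally_lipschitz_from_above f)
  (hf : (f 0 = 0 /\ forall tbar : R, 0 <= tbar -> one_sided_osgood f tbar) \/
        (f 0 <> 0 /\ forall tbar : R, 0 < tbar -> one_sided_osgood f tbar)) :
  forall x y : R, open_half_plane (x, y) -> 0 < Derive (fun t => u (x, t)) y.
Proof.
  intros x y Hy.
  destruct (solution_extension f u hu hsol) as [S HS].
  rewrite HS by exact Hy.
  apply du_y_pos; [exact hfc|exact hfL| | |exact Hy].
  - destruct hf as [[_ H]|[_ H]]; intros t Ht; apply H; lra.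
  - destruct hf as [[H0 H]|[H0 _]]; [right|left; exact H0].
    split; [exact H0|apply H; lra].
Qed.
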